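(* Let $\mathcal{H}$ be a real Hilbert space and assume that the following conditions hold. (1) $\Psi:\mathcal{H}\to[0,+\infty)$ is convex and Fréchet differentiable with Lipschitz continuous gradient, and $\operatorname{argmin}\Psi=\Psi^{-1}(0)\neq\emptyset$. (2) $\Theta:\mathcal{H}\to\mathbb{R}$ is convex and Fréchet differentiable with Lipschitz continuous gradient. (3) $\Phi:\mathcal{H}\to\mathbb{R}\cup\{+\infty\}$ is convex and lower semicontinuous, and $$S:=\{z\in\operatorname{argmin}\Psi\cap\operatorname{dom}\Phi:\ \Phi(z)+\Theta(z)\le\Phi(x)+\Theta(x)\ \ \forall x\in\operatorname{argmin}\Psi\}\neq\emptyset.$$ (4) $\lambda:[0,+\infty)\to(0,+\infty)$ is locally absolutely continuous, $\dot\lambda(t)\le 0$ for almost every $t\in[0,+\infty)$, and $\lim_{t\to+\infty}\lambda(t)>0$. (5) $\beta:[0,+\infty)\to(0,+\infty)$ is locally absolutely continuous, for some $k\ge 0$ it satisfies $0\le\dot\beta(t)\le k\beta(t)$ for almost every $t\in[0,+\infty)$, and $\lim_{t\to+\infty}\beta(t)=+\infty$. (6) For every $p\in\operatorname{ran}N_{\operatorname{argmin}\Psi}$, $$\int_0^{+\infty}\beta(t)\left[\Psi^*\left(\frac{p}{\beta(t)}\right)-\sigma_{\operatorname{argmin}\Psi}\left(\frac{p}{\beta(t)}\right)\right]dt<+\infty.$$ (7) $\partial(\Phi+\Theta+\delta_{\operatorname{argmin}\Psi})=\partial\Phi+\nabla\Theta+N_{\operatorname{argmin}\Psi}$. Let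 $x_0\in\mathcal{H}$, $v_0\in\partial\Phi(x_0)$, and let $(x,v):[0,+\infty)\to\mathcal{H}\times\mathcal{H}$ be a strong global solution of the dynamical system $$v(t)\in\partial\Phi(x(t)),\qquad \lambda(t)\dot x(t)+\dot v(t)+v(t)+\nabla\Theta(x(t))+\beta(t)\nabla\Psi(x(t))=0,\qquad x(0)=x_0,\ v(0)=v_0.$$ Then the following statements are true: (i) $\int_0^{+\infty}\beta(t)\Psi(x(t))\,dt<+\infty$; (ii) $\dot x\in L^2([0,+\infty);\mathcal{H})$; (iii) $\langle\dot x,\dot v\rangle\in L^1([0,+\infty))$; (iv) $(\Phi+\Theta)(x(t))$ converges, as $t\to+\infty$, to the optimal objective value of the problem $\inf_{x\in\operatorname{argmin}\Psi}\{\Phi(x)+\Theta(x)\}$; (v) $\lim_{t\to+\infty}\Psi(x(t))=\lim_{t\to+\infty}\beta(t)\Psi(x(t))=0$; (vi) $x(t)$ converges weakly, as $t\to+\infty$, to an optimal solution of $\inf_{x\in\operatorname{argmin}\Psi}\{\Phi(x)+\Theta(x)\}$ (that is, to an element of $S$).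
   Context: $\mathcal{H}$ has inner product $\langle\cdot,\cdot\rangle$ and norm $\|\cdot\|=\sqrt{\langle\cdot,\cdot\rangle}$. $\operatorname{dom}\Phi=\{x\in\mathcal{H}:\Phi(x)<+\infty\}$. The convex subdifferential is $\partial\Phi(x)=\{p\in\mathcal{H}:\Phi(y)\ge\Phi(x)+\langle p,y-x\rangle\ \forall y\in\mathcal{H}\}$ if $\Phi(x)\in\mathbb{R}$, and $\partial\Phi(x)=\emptyset$ otherwise (similarly for other extended-real-valued functions). For a set $C\subseteq\mathcal{H}$ (here $C=\operatorname{argmin}\Psi$): the normal cone is $N_C(x)=\{p\in\mathcal{H}:\langle p,y-x\rangle\le0\ \forall y\in C\}$ for $x\in C$ and $N_C(x)=\emptyset$ for $x\notin C$; $\operatorname{ran}N_C$ is the set of all $p$ with $p\in N_C(x)$ for some $x\in C$; $\sigma_C(p)=\sup_{x\in C}\langle p,x\rangle$ is the support function; $\delta_C$ is the indicator function ($0$ on $C$, $+\infty$ otherwise). The Fenchel conjugate is $\Psi^*(p)=\sup_{x\in\mathcal{H}}\{\langle p,x\rangle-\Psi(x)\}$. The equality in (7) is an equality of set-valued operators on $\mathcal{H}$, with the Minkowski sum on the right. A function $x:[0,b]\to\mathcal{H}$ is absolutely continuous if there is an integrable $y:[0,b]\to\mathcal{H}$ with $x(t)=x(0)+\int_0^t y(s)\,ds$ for all $t\in[0,b]$ (then $\dot x=y$ almost everywhere). A function on $[0,+\infty)$ is locally absolutely continuous if it is absolutely continuous on $[0,b]$ for every $0<b<+\infty$. A pair $(x,v)$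 is a strong global solution of the dynamical system if: $x,v:[0,+\infty)\to\mathcal{H}$ are locally absolutely continuous; $v(t)\in\partial\Phi(x(t))$ for every $t\in[0,+\infty)$; the differential equation holds for almost every $t\in[0,+\infty)$; and $x(0)=x_0$, $v(0)=v_0$. *)

(* Defs.v *)
From HB Require Import structures.
From mathcomp Require Import all_boot all_order all_algebra.
From mathcomp Require Import all_classical all_reals all_analysis.

Set Implicit Arguments.
Unset Strict Implicit.
Unset Printing Implicit Defensive.

Import Order.TTheory GRing.Theory Num.Theory.
Import numFieldNormedType.Exports.

Local Open Scope classical_set_scope.
Local Open Scope ring_scope.

HB.mixin Record CompleteNormedModule_isHilbert (R : realType) H
    of CompleteNormedModule R H := {
  inner : H -> H -> R ;
  innerC : forall x y, inner x y = inner y x ;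
  innerDl : forall x y z, inner (x + y) z = inner x z + inner y z ;
  innerZl : forall (a : R) x y, inner (a *: x) y = a * inner x y ;
  inner_ge0 : forall x, 0 <= inner x x ;
  (* with [normr0_eq0] this also gives definiteness *)
  norm_inner : forall x, `|x| = Num.sqrt (inner x x) }.

#[short(type="hilbertType")]
HB.structure Definition Hilbert (R : realType) :=
  { H of CompleteNormedModule_isHilbert R H & CompleteNormedModule R H }.

Section Bochner.
Context {R : realType} {V : normedModType R}.
Local Notation mu := (@lebesgue_measure R).

Record simple_fun := SimpleFun {
  sf_size : nat ;
  sf_set : 'I_sf_size -> set R ;
  sf_val : 'I_sf_size -> V ;
  sf_measurable : forall i, measurable (sf_set i) ;
  sf_finite : forall i, (mu (sf_set i) < +oo)%E }.

Definition sf_eval (s : simple_fun) (t : R) : V :=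
  \sum_(i < sf_size s) (\1_(sf_set i) t : R) *: sf_val i.

Definition sf_integral (D : set R) (s : simple_fun) : V :=
  \sum_(i < sf_size s) fine (mu (sf_set i `&` D)) *: sf_val i.

Definition ae_approx (D : set R) (s : nat -> simple_fun) (f : R -> V) : Prop :=
  {ae mu, forall t, D t -> sf_eval (s n) t @[n --> \oo] --> f t}.

Definition strongly_measurable (D : set R) (f : R -> V) : Prop :=
  exists s : nat -> simple_fun, ae_approx D s f.

(* [I] is the Bochner integral of [f] over [D]. Since [f] is only required to
   be an a.e. limit of simple functions, the integrands [`|f t - s n t|] may
   fail to be Borel; the library integral of a nonnegative function is a
   supremum over simple minorants and is insensitive to null sets here. *)
Definition is_bochner_integral (D : set R) (f : R -> V) (I : V) : Prop :=
  exists s : nat -> simple_fun, [/\ ae_approx D s f,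
    (\int[mu]_(t in D) (`|f t - sf_eval (s n) t|)%:E)%E @[n --> \oo] --> 0%E &
    sf_integral D (s n) @[n --> \oo] --> I].

Definition bochner_integrable (D : set R) (f : R -> V) : Prop :=
  exists I, is_bochner_integral D f I.

(* functions representing a class of L^p(D; V) *)
Definition in_Lp (p : nat) (D : set R) (f : R -> V) : Prop :=
  strongly_measurable D f /\ (\int[mu]_(t in D) (`|f t| ^+ p)%:E < +oo)%E.

Definition absolutely_continuous (b : R) (x : R -> V) : Prop :=
  exists y : R -> V, bochner_integrable `[0, b] y /\
    forall t : R, 0 <= t <= b ->
      exists2 I, is_bochner_integral `[0, t] y I & x t = x 0 + I.

(* functions on [0, +oo[ are represented by total functions whose values at
   negative reals are irrelevant *)
Definition locally_absolutely_continuous (x : R -> V) : Prop :=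
  forall b, 0 < b -> absolutely_continuous b x.

End Bochner.

Section ConvexAnalysis.
Context {R : realType} {H : hilbertType R}.
Implicit Types (f : H -> \bar R) (g : H -> R) (C : set H).
Local Open Scope ereal_scope.

Definition dom f : set H := [set x | f x < +oo].

Definition ereal_convex f : Prop :=
  forall (x y : H) (t : R), (0 < t < 1)%R ->
    f (t *: x + (1 - t) *: y)%R <= t%:E * f x + (1 - t)%:E * f y.

Definition subdiff f (x : H) : set H :=
  [set p | f x \is a fin_num /\ forall y, f x + (inner p (y - x)%R)%:E <= f y].

Definition normal_cone C (x : H) : set H :=
  [set p | C x /\ forall y, C y -> (inner p (y - x) <= 0)%R].

Definition ran_normal_cone C : set H :=
  [set p | exists2 x, C x & normal_cone C x p].

Definition support_fun C (p : H) : \bar R :=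
  ereal_sup [set (inner p x)%:E | x in C].

Definition indicator_fun C (x : H) : \bar R := if x \in C then 0 else +oo.

Definition conjugate f (p : H) : \bar R :=
  ereal_sup [set (inner p x)%:E - f x | x in setT].

Definition argmin g : set H := [set x | forall y, (g x <= g y)%R].

(* the Riesz representative of the Frechet differential (a junk value where
   [g] is not differentiable) *)
Definition gradient g (x : H) : H :=
  xget 0%R [set u | forall h, 'd (g : H -> R^o) x h = inner u h].

Definition Frechet_differentiable g : Prop :=
  forall x, differentiable (g : H -> R^o) x.

Definition optimal_solutions (Phi : H -> \bar R) (Theta Psi : H -> R) : set H :=
  [set z | [/\ argmin Psi z, dom Phi z &
     forall x, argmin Psi x -> Phi z + (Theta z)%:E <= Phi x + (Theta x)%:E]].

Definition optimal_value (Phi : H -> \bar R) (Theta Psi : H -> R) : \bar R :=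
  ereal_inf [set Phi x + (Theta x)%:E | x in argmin Psi].

Definition weakly_cvg_pinfty (x : R -> H) (z : H) : Prop :=
  forall w, (inner (x t) w : R^o) @[t --> +oo%R] --> (inner z w : R^o).

End ConvexAnalysis.

Section DynamicalSystem.
Context {R : realType} {H : hilbertType R}.

(* Differentiability of [x] and [v] at almost every time is spelled out because
   'D_1 is a total operator. *)
Definition strong_global_solution (Phi : H -> \bar R) (Theta Psi : H -> R)
    (lambda beta : R -> R) (x0 v0 : H) (x v : R -> H) : Prop :=
  [/\ locally_absolutely_continuous x /\ locally_absolutely_continuous v,
      (forall t : R, 0 <= t -> subdiff Phi (x t) (v t)),
      {ae (@lebesgue_measure R), forall t : R, 0 <= t ->
        [/\ derivable x t 1, derivable v t 1 &
            lambda t *: 'D_1 x t + 'D_1 v t + v t + gradient Theta (x t)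
              + beta t *: gradient Psi (x t) = 0]} &
      x 0 = x0 /\ v 0 = v0].

End DynamicalSystem.

(* Main.v *)
Require Import Defs.
From mathcomp Require Import all_boot all_order all_algebra.
From mathcomp Require Import all_classical all_reals all_analysis.
From mathcomp Require Import measurable_realfun lra ring.

(* Fix z in S. By (7) there is p in N_C(z), C = argmin Psi, with
   -(p + grad Theta(z)) in the subdifferential of Phi at z. Along the trajectory
   the function h = lambda/2 |x - z|^2 + (Phi(z) - Phi(x) + <v, x - z>)
   decreases up to half of the gap w = <2p, x - z> - beta Psi(x), which is
   dominated by the integrand of (6) at 2p; hence beta Psi(x) is integrable and
   h converges. The energy Phi(x) + Theta(x) + beta Psi(x) has derivative at most
   k beta Psi(x) - lambda |x'|^2 - <x', v'> with <x', v'> >= 0, which gives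
   (ii), (iii) and the convergence of the energy. Its limit is at most the optimal
   value by integrability, and at least that value because beta is nondecreasing,
   so that w(t) <= K / t. Finally the Bregman part of h is integrable and |x - z|^2
   varies slowly, so |x - z| converges and Opial's lemma applies.

   Derivatives exist only almost everywhere, so monotonicity comes from a substitute
   for absolute continuity ([null_variation]) that passes to inner products and to
   values of convex functions along a curve without any integration. *)

Set Implicit Arguments.
Unset Strict Implicit.
Unset Printing Implicit Defensive.

Import Order.TTheory GRing.Theory Num.Theory.
Import numFieldNormedType.Exports.
Import HBNNSimple.

Local Open Scope classical_set_scope.
Local Open Scope ring_scope.

(** * Bochner integrals and domination of absolutely continuous curves *)

(** [Phi] is only extended-valued and semicontinuous, so no chain rule applies to it along the
    trajectory. But v(t) is a subgradient at x(t): the two subgradient inequalities between times s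
    and t enclose the increment of Phi(x), and continuity of v then gives both its derivative and a
    bound by the increment of x.

    Absolute continuity is used only through a scalar function whose integral dominates the
    increments of the curve. The integral of that function, up to time r, over a small open
    neighbourhood of a null set is a monotone function of r with small total variation. Adding it
    absorbs whatever happens at the exceptional times.

    Integrands such as |x'| need not be Borel. Integrals of nonnegative functions are therefore
    compared as suprema over simple minorants, and strong measurability of derivatives comes from
    difference quotients.

    [H] is not assumed separable, so weak compactness is obtained along ultrafilters from the Riesz
    representation rather than by extracting sequences. *)

(** A simple minorant of [f] restricted to [D] is also one of [g] restricted to [E], so no
    measurability is involved. *)
Lemma ge0_lower_integral_le d (T : measurableType d) (R : realType)
    (mu : {measure set T -> \bar R}) (D E : set T) (f g : T -> \bar R) :
  D `<=` E -> (forall x, D x -> (0 <= f x <= g x)%E) ->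
  (forall x, E x -> (0 <= g x)%E) ->
  (\int[mu]_(x in D) f x <= \int[mu]_(x in E) g x)%E.
Proof.
move=> DE fg g0; rewrite !ge0_integralE//; last by move=> x /fg /andP[].
apply: ereal_sup_le => _ [h /= hf <-]; exists h => //= x.
apply: le_trans (hf x) _; rewrite !patchE.
case: ifPn => [/set_mem Dx|_].
  by rewrite mem_set; [have /andP[] := fg _ Dx|exact: DE].
by case: ifPn => // /set_mem /g0.
Qed.

Section indicator_sums.
Context {R : realType} {V : normedModType R} {I : Type}.
Notation mu := (@lebesgue_measure R).

(** [V] carries no measurable structure, so measurability concerns scalar images. The sum takes
    finitely many values, hence [phi] is arbitrary, and the induction absorbs each [v i] into it. *)
Lemma measurable_fun_indic_sum (phi : V -> R) (r : seq I) (A : I -> set R)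
    (v : I -> V) : (forall i, measurable (A i)) ->
  measurable_fun setT (fun t : R => phi (\sum_(i <- r) (\1_(A i) t : R) *: v i)).
Proof.
move=> mA; elim: r phi => [|i r IH] phi.
  by under eq_fun do rewrite big_nil; exact: measurable_cst.
have -> : (fun t : R => phi (\sum_(j <- i :: r) (\1_(A j) t : R) *: v j)) =
    (fun t => \1_(A i) t * phi (v i + \sum_(j <- r) (\1_(A j) t : R) *: v j)
      + (1 - \1_(A i) t) * phi (\sum_(j <- r) (\1_(A j) t : R) *: v j)).
  apply/funext => t; rewrite big_cons; rewrite [\1_(A i) t]indicE.
  case: (t \in A i) => /=.
    by rewrite scale1r subrr mul0r addr0 mul1r.
  by rewrite scale0r add0r mul0r add0r subr0 mul1r.
have mi : measurable_fun setT (\1_(A i) : R -> R) by exact: measurable_indic.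
apply: measurable_funD; apply: measurable_funM => //.
- exact: (IH (fun w => phi (v i + w))).
- exact: measurable_funB.
Qed.

(** The sets [A i] may overlap. The induction splits [D] along the first of them and moves its value
    into the constant [u], which is why the statement carries [u]. *)
Lemma norm_indic_sum_le (r : seq I) (A : I -> set R) (v : I -> V) (u : V)
    (D : set R) : (forall i, measurable (A i)) -> measurable D ->
  (mu D < +oo)%E ->
  (`|fine (mu D) *: u + \sum_(i <- r) fine (mu (A i `&` D)) *: v i|%:E <=
   \int[mu]_(t in D) `|u + \sum_(i <- r) (\1_(A i) t : R) *: v i|%:E)%E.
Proof.
move=> mA; elim: r u D => [|i r IH] u D mD Dfin.
  under eq_integral do rewrite big_nil addr0.
  rewrite big_nil addr0 integral_cst// normrZ ger0_norm ?fine_ge0//.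
  by rewrite mulrC EFinM fineK// ge0_fin_numE.
have mfin B : measurable B -> B `<=` D -> mu B \is a fin_num.
  move=> mB BD; rewrite ge0_fin_numE// (le_lt_trans _ Dfin)//.
  by rewrite le_measure// inE.
pose D1 := D `&` A i; pose D2 := D `\` A i.
have mD1 : measurable D1 by exact: measurableI.
have mD2 : measurable D2 by exact: measurableD.
have DE : D = D1 `|` D2 by rewrite /D1 /D2 setUIDK.
have D12 : [disjoint D1 & D2].
  apply/disj_set2P; rewrite /D1 /D2; apply/seteqP; split => // x.
  by move=> [[_ ?] [_]].
have mus B : measurable B ->
    fine (mu (B `&` D)) = fine (mu (B `&` D1)) + fine (mu (B `&` D2)).
  move=> mB; rewrite -fineD; first last.
  - apply: mfin; first exact: measurableI.
    by move=> x [_ []].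
  - apply: mfin; first exact: measurableI.
    by move=> x [_ []].
  congr fine; rewrite {1}DE setIUr measureU//; try exact: measurableI.
  apply/seteqP; split => // x [[_ x1] [_ x2]].
  by move/disj_set2P : D12 => <-; split.
have -> : fine (mu D) *: u +
    \sum_(j <- i :: r) fine (mu (A j `&` D)) *: v j =
  (fine (mu D1) *: (u + v i) + \sum_(j <- r) fine (mu (A j `&` D1)) *: v j) +
  (fine (mu D2) *: u + \sum_(j <- r) fine (mu (A j `&` D2)) *: v j).
  have := mus _ measurableT; rewrite !setTI => ->.
  rewrite big_cons.
  have -> : A i `&` D = D1 by rewrite setIC.
  under eq_bigr do rewrite mus// scalerDl.
  rewrite big_split/= scalerDl scalerDr.
  set a := _ *: u; set b := _ *: u; set c := _ *: v i.
  set s1 := \sum_(j <- r) _; set s2 := \sum_(j <- r) _.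
  rewrite !addrA; congr (_ + s2).
  by rewrite -!addrA; congr (a + _); rewrite addrC -!addrA; congr (c + _); rewrite addrC.
rewrite {1}DE ge0_integral_setU//; last first.
  apply/measurable_EFinP/measurable_funTS.
  exact: (measurable_fun_indic_sum (fun w => `|u + w|)).
set p := _ *: (u + v i) + _; set q := _ *: u + _.
have /le_trans -> // : (`|p + q|%:E <= `|p|%:E + `|q|%:E)%E.
  by rewrite -EFinD lee_fin ler_normD.
apply: leeD.
  apply: le_trans (IH _ _ mD1 _) _; first by rewrite -ge0_fin_numE// mfin// => x [].
  apply: ge0_lower_integral_le => // t [_ At]; rewrite big_cons.
  by rewrite indicE mem_set//= scale1r addrA lexx andbT lee_fin.
apply: le_trans (IH _ _ mD2 _) _; first by rewrite -ge0_fin_numE// mfin// => x [].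
apply: ge0_lower_integral_le => // t [_ At]; rewrite big_cons.
by rewrite indicE memNset//= scale0r add0r lexx andbT lee_fin.
Qed.

End indicator_sums.

Section bochner_domination.
Context {R : realType} {V : normedModType R}.
Notation mu := (@lebesgue_measure R).
Implicit Types (s : @simple_fun R V) (D : set R).

(** Indexing by the disjoint union keeps the difference of two simple functions a single indicator
    sum. *)
Definition sfB_set s1 s2 (k : 'I_(sf_size s1) + 'I_(sf_size s2)) : set R :=
  match k with inl i => sf_set i | inr j => sf_set j end.

Definition sfB_val s1 s2 (k : 'I_(sf_size s1) + 'I_(sf_size s2)) : V :=
  match k with inl i => sf_val i | inr j => - sf_val j end.

Lemma measurable_sfB_set s1 s2 k : measurable (@sfB_set s1 s2 k).
Proof. by case: k => k /=; exact: sf_measurable. Qed.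

Lemma sf_evalB s1 s2 t : sf_eval s1 t - sf_eval s2 t =
  \sum_k (\1_(@sfB_set s1 s2 k) t : R) *: sfB_val k.
Proof.
rewrite big_sumType/= -sumrN; congr (_ + _).
by apply: eq_bigr => i _; rewrite scalerN.
Qed.

Lemma sf_integralB D s1 s2 : sf_integral D s1 - sf_integral D s2 =
  \sum_k fine (mu (@sfB_set s1 s2 k `&` D)) *: sfB_val k.
Proof.
rewrite big_sumType/= -sumrN; congr (_ + _).
by apply: eq_bigr => i _; rewrite scalerN.
Qed.

Lemma measurable_norm_sf_evalB s1 s2 :
  measurable_fun setT (fun t : R => `|sf_eval s1 t - sf_eval s2 t|).
Proof.
under eq_fun do rewrite sf_evalB.
by apply: measurable_fun_indic_sum; exact: measurable_sfB_set.
Qed.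

Lemma measurable_norm_sf_eval s :
  measurable_fun setT (fun t : R => `|sf_eval s t|).
Proof. by apply: measurable_fun_indic_sum => i; exact: sf_measurable. Qed.

Lemma norm_sf_integralB_le D s1 s2 : measurable D -> (mu D < +oo)%E ->
  (`|sf_integral D s1 - sf_integral D s2|%:E <=
   \int[mu]_(t in D) `|sf_eval s1 t - sf_eval s2 t|%:E)%E.
Proof.
move=> mD Dfin; under eq_integral do rewrite sf_evalB; rewrite sf_integralB.
have := norm_indic_sum_le (index_enum _) (@sfB_val s1 s2) 0
  (@measurable_sfB_set s1 s2) mD Dfin.
rewrite scaler0 add0r => /le_trans; apply.
rewrite le_eqVlt; apply/orP; left; apply/eqP.
by apply: eq_integral => t _; rewrite add0r.
Qed.

Lemma norm_sf_integral_le D s : measurable D -> (mu D < +oo)%E ->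
  (`|sf_integral D s|%:E <= \int[mu]_(t in D) `|sf_eval s t|%:E)%E.
Proof.
move=> mD Dfin.
have := norm_indic_sum_le (index_enum _) (@sf_val _ _ s) 0
  (@sf_measurable _ _ s) mD Dfin.
rewrite scaler0 add0r => /le_trans; apply.
rewrite le_eqVlt; apply/orP; left; apply/eqP.
by apply: eq_integral => t _; rewrite add0r.
Qed.

Lemma ae_approx_ex D (s : nat -> simple_fun) (f : R -> V) : ae_approx D s f ->
  exists N, [/\ measurable N, mu N = 0 & forall t, (D `\` N) t ->
    sf_eval (s n) t @[n --> \oo] --> f t].
Proof.
move=> [N [mN N0 HN]]; exists N; split=> // t [Dt Nt].
by apply: contrapT => h; apply: Nt; apply: HN => /(_ Dt).
Qed.

Lemma measurable_norm_approxB D (s : nat -> simple_fun) (f : R -> V) s' :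
  (forall t, D t -> sf_eval (s n) t @[n --> \oo] --> f t) ->
  measurable_fun D (fun t : R => `|f t - sf_eval s' t|).
Proof.
move=> sf; apply: (@measurable_fun_cvg _ _ _ _
    (fun n t => `|sf_eval (s n) t - sf_eval s' t|)).
  by move=> n; apply: measurable_funTS; exact: measurable_norm_sf_evalB.
move=> t Dt; apply: cvg_norm; apply: cvgB; first exact: sf.
exact: cvg_cst.
Qed.

Lemma measurable_norm_approx D (s : nat -> simple_fun) (f : R -> V) :
  (forall t, D t -> sf_eval (s n) t @[n --> \oo] --> f t) ->
  measurable_fun D (fun t : R => `|f t|).
Proof.
move=> sf; apply: (@measurable_fun_cvg _ _ _ _ (fun n t => `|sf_eval (s n) t|)).
  by move=> n; apply: measurable_funTS; exact: measurable_norm_sf_eval.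
by move=> t Dt; apply: cvg_norm; exact: sf.
Qed.

(** Passage to the limit in the inequality for two simple functions, along the sequence that defines
    [I]: the extra term, the distance of that sequence to [f], tends to 0. *)
Lemma norm_bochner_integralB_le D (f : R -> V) I s :
  measurable D -> (mu D < +oo)%E -> is_bochner_integral D f I ->
  (`|I - sf_integral D s|%:E <=
   \int[mu]_(t in D) `|f t - sf_eval s t|%:E)%E.
Proof.
move=> mD Dfin [s' [/ae_approx_ex[N [mN N0 s'f]] intf s'I]].
set c := (leRHS).
pose g n := (\int[mu]_(t in D) `|f t - sf_eval (s' n) t|%:E + c)%E.
have cf : (`|sf_integral D (s' n) - sf_integral D s|%:E @[n --> \oo] -->
    `|I - sf_integral D s|%:E)%E.
  by apply: cvg_EFin; [exact: nearW|apply: cvg_norm; apply: cvgB => //; exact: cvg_cst].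
have cg : g n @[n --> \oo] --> c.
  rewrite -[X in _ --> X]add0e; apply: cvgeD => //.
  exact: cvg_cst.
apply: lee_cvg_to cf cg _; apply: nearW => n.
apply: le_trans (norm_sf_integralB_le _ _ mD Dfin) _.
(* Off the null set [N] the norms are limits of measurable functions, so the integral of a sum may
   be split there. *)
have mDN : measurable (D `\` N) by exact: measurableD.
rewrite (ge0_negligible_integral mN)//; last first.
  by apply/measurable_EFinP/measurable_funTS; exact: measurable_norm_sf_evalB.
have m1 := measurable_norm_approxB (s' n) s'f.
have m2 := measurable_norm_approxB s s'f.
apply: (@le_trans _ _ (\int[mu]_(t in D `\` N)
   (`|f t - sf_eval (s' n) t|%:E + `|f t - sf_eval s t|%:E)))%E.
  apply: ge0_lower_integral_le => // t _; rewrite ?adde_ge0 ?lee_fin//=.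
  rewrite normr_ge0/= -(subrKA (f t)) [X in _ <= X + _]distrC.
  exact: ler_normD.
rewrite ge0_integralD//; try exact/measurable_EFinP.
apply: leeD; apply: ge0_lower_integral_le => // t; try by case.
- by rewrite lexx lee_fin normr_ge0.
- by rewrite lexx lee_fin normr_ge0.
Qed.

Lemma sf_integral_itv s (a b : R) : 0 <= a -> a <= b ->
  sf_integral `[0, b] s - sf_integral `[0, a] s = sf_integral `]a, b] s.
Proof.
move=> a0 ab; rewrite -sumrB; apply: eq_bigr => i _.
rewrite -scalerBl; congr (_ *: _); apply/eqP; rewrite subr_eq; apply/eqP.
have mi := sf_measurable i.
have h (c d : R) (u v : bool) :
    mu (sf_set i `&` [set` Interval (BSide u c) (BSide v d)]) \is a fin_num.
  rewrite ge0_fin_numE// (le_lt_trans _ (sf_finite i))//.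
  by rewrite le_measure// inE//; exact: measurableI.
rewrite -fineD ?h//; congr fine.
rewrite [X in _ `&` X](@itv_bndbnd_setU _ _ _ (BRight a))//=.
rewrite setIUr measureU//; [by rewrite addeC|exact: measurableI|exact: measurableI|].
apply/seteqP; split => // x /= [[_ +] [_]]; rewrite !in_itv/=.
by move=> /andP[_ xa] /andP[]; rewrite ltNge xa.
Qed.

Lemma sf_norm_bounded s : exists2 C, 0 <= C & forall t, `|sf_eval s t| <= C.
Proof.
exists (\sum_(i < sf_size s) `|sf_val i|); first by rewrite sumr_ge0.
move=> t; rewrite (le_trans (ler_norm_sum _ _ _))// ler_sum// => i _.
rewrite normrZ ger0_norm// ?indicE//.
by case: (_ \in _); rewrite ?mul1r ?mul0r.
Qed.

(** The dominating function is the norm of the density [y], set to 0 off the set where its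
    approximants converge, which makes it measurable. Each integral over [[0, t]] comes with its own
    approximants; all are compared with the fixed sequence for [[0, b]]. *)
Lemma absolutely_continuous_dominated (b : R) (x : R -> V) :
  0 < b -> absolutely_continuous b x ->
  exists m : R -> R, [/\ measurable_fun setT m, forall t, 0 <= m t,
    (\int[mu]_t (m t)%:E < +oo)%E & forall a c, 0 <= a -> a <= c -> c <= b ->
    (`|x c - x a|%:E <= \int[mu]_(t in `]a, c]) (m t)%:E)%E].
Proof.
move=> b0 [y [[I [s [/ae_approx_ex[N [mN N0 sy]] inty _]]] xI]].
pose D := `[0, b]%classic `\` N.
have mD : measurable D by exact: measurableD.
have my : measurable_fun D (fun t => `|y t|) := measurable_norm_approx sy.
have mys n : measurable_fun D (fun t => `|y t - sf_eval (s n) t|).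
  exact: measurable_norm_approxB sy.
have Dfin : (mu D < +oo)%E.
  apply: (@le_lt_trans _ _ (mu `[0, b])).
    by rewrite le_measure// ?inE// => t [].
  by rewrite lebesgue_measure_itv/=; case: ifP => // _; rewrite ltry.
pose e n := (\int[mu]_(t in `[0%R, b]) `|y t - sf_eval (s n) t|%:E)%E.
have se n (A : set R) : A `<=` `[0, b] ->
    (\int[mu]_(t in A) `|y t - sf_eval (s n) t|%:E <= e n)%E.
  by move=> Ab; apply: ge0_lower_integral_le => // t _; rewrite lexx lee_fin normr_ge0.
pose m := (fun t => `|y t|) \_ D.
have mm : measurable_fun setT m by apply/(measurable_restrictT _ _).1.
have m0 t : 0 <= m t by rewrite /m patchE; case: ifP.
have int_m (A : set R) : measurable A ->
    (\int[mu]_(t in A) (m t)%:E = \int[mu]_(t in A `&` D) `|y t|%:E)%E.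
  move=> mA; rewrite integral_mkcondr; apply: eq_integral => t _.
  by rewrite /m /= !patchE; case: ifP.
exists m; split => //.
  (* A bounded approximant at distance less than 1 makes [m] integrable. *)
  have [C C0 sC] : exists2 n, True & (e n < 1)%E.
    have /fine_cvgP[h1 /cvgrPdist_lt /(_ _ ltr01) h2] := inty.
    near \oo => n; exists n => //.
    have h3 : e n \is a fin_num by near: n.
    rewrite -(fineK h3) lte_fin.
    have : `|0 - fine (e n)| < 1 by near: n.
    by rewrite sub0r normrN ger0_norm// fine_ge0// integral_ge0.
  have [K K0 sK] := sf_norm_bounded (s C).
  rewrite int_m// setTI.
  apply: (@le_lt_trans _ _ (\int[mu]_(t in D)
     (`|y t - sf_eval (s C) t|%:E + K%:E)))%E.
    apply: ge0_lower_integral_le => // t _; rewrite -EFinD !lee_fin ?addr_ge0//.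
    rewrite normr_ge0/= -[X in `|X| <= _](subrK (sf_eval (s C) t)).
    by apply: le_trans (ler_normD _ _) _; rewrite lerD2l.
  rewrite ge0_integralD//; last by apply/measurable_EFinP; exact: mys.
  rewrite lte_add_pinfty//.
    by apply: (le_lt_trans (se C D _)); [move=> t []|exact: lt_trans sC (ltry _)].
  by rewrite integral_cst// lte_mul_pinfty// ltry.
move=> a c a0 ac cb.
have [Ia bIa xa] := xI a (introT andP (conj a0 (le_trans ac cb))).
have [Ic bIc xc] := xI c (introT andP (conj (le_trans a0 ac) cb)).
have fin_itv (u v : bool) (p q : R) :
    (mu [set` Interval (BSide u p) (BSide v q)] < +oo)%E.
  by rewrite lebesgue_measure_itv/=; case: ifP => // _; rewrite ltry.
have sub d : d <= b -> `[0, d]%classic `<=` `[0, b]%classic.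
  by move=> db t /=; rewrite !in_itv/= => /andP[-> td]; exact: le_trans td db.
set J := (leRHS).
(* Of the three errors [e n], two compare the integrals up to [c] and up to [a] with those of [s n],
   and one compares [s n] with [y] on []a, c]]. *)
have key n : (`|x c - x a|%:E <= J + (e n + (e n + e n)))%E.
  have subD4 (p q u w : V) : u - w = (p - q) + ((u - p) - (w - q)).
    have -> : (u - p) - (w - q) = (u - w) - (p - q).
      by rewrite !opprD !opprK addrACA.
    by rewrite [RHS]addrC subrK.
  have -> : x c - x a = sf_integral `]a, c] (s n) +
      ((Ic - sf_integral `[0, c] (s n)) - (Ia - sf_integral `[0, a] (s n))).
    by rewrite -sf_integral_itv// xc xa opprD addrACA subrr add0r -subD4.
  apply: (@le_trans _ _ (`|sf_integral `]a, c] (s n)|%:E +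
     (`|Ic - sf_integral `[0, c] (s n)|%:E +
      `|Ia - sf_integral `[0, a] (s n)|%:E))%E).
    rewrite -!EFinD lee_fin (le_trans (ler_normD _ _))// lerD2l.
    by rewrite (le_trans (ler_normB _ _)).
  rewrite [leRHS]addeA; apply: leeD; last first.
    apply: leeD.
      apply: le_trans (norm_bochner_integralB_le _ _ _ bIc) _ => //.
      exact/se/sub.
    apply: le_trans (norm_bochner_integralB_le _ _ _ bIa) _ => //.
    exact/se/sub/(le_trans ac).
  apply: le_trans (norm_sf_integral_le _ _ _) _ => //.
  have mAN : measurable (`]a, c]%classic `\` N) by exact: measurableD.
  have AD : `]a, c]%classic `\` N `<=` D.
    move=> t [/= + ?]; rewrite in_itv/= => /andP[/ltW at_ tc]; split=> //=.
    by rewrite in_itv/= (le_trans a0 at_) (le_trans tc cb).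
  rewrite (ge0_negligible_integral mN)//; last first.
    by apply/measurable_EFinP/measurable_funTS; exact: measurable_norm_sf_eval.
  apply: (@le_trans _ _ (\int[mu]_(t in `]a, c] `\` N)
     (`|y t|%:E + `|y t - sf_eval (s n) t|%:E)))%E.
    apply: ge0_lower_integral_le => // t _; rewrite -EFinD !lee_fin ?addr_ge0//.
    rewrite normr_ge0/= -[X in `|X| <= _](subrK (y t)) addrC distrC.
    by rewrite (le_trans (ler_normD _ _))// addrC.
  rewrite ge0_integralD//; first last.
  - by apply/measurable_EFinP; exact: measurable_funS mD AD (mys n).
  - by apply/measurable_EFinP; exact: measurable_funS mD AD my.
  apply: leeD.
    rewrite /J int_m//; apply: ge0_lower_integral_le => // t.
      by move=> At; split; [case: At|exact: AD].
    by rewrite lexx lee_fin normr_ge0.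
  by apply: se => t /AD [].
have cJ : (J + (e n + (e n + e n)))%E @[n --> \oo] --> J.
  rewrite -[X in _ --> X]adde0; apply: cvgeD.
  - by rewrite fin_num_adde_defl.
  - exact: cvg_cst.
  rewrite -[X in _ --> X]adde0; apply: cvgeD => //.
  by rewrite -[X in _ --> X]adde0; apply: cvgeD.
apply: (lee_cvg_to _ cJ (nearW _ key)).
exact: (cvg_cst (`|x c - x a|%:E)%E).
Unshelve. all: by end_near. Qed.

End bochner_domination.

(** * Monotonicity from almost everywhere derivatives *)

Section first_order.
Context {R : realType} {V : normedModType R}.
Implicit Types (f : R -> V) (t : R).

Lemma is_derive_near f t (d : V) e : is_derive t 1 f d -> 0 < e ->
  \forall s \near t, `|f s - f t - (s - t) *: d| <= e * `|s - t|.
Proof.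
move=> [df fd] e0.
have : h^-1 *: (f (h *: 1 + t) - f t) @[h --> 0^'] --> d by rewrite -fd.
move/cvgrPdist_le => /(_ _ e0) [r /= r0 hr].
exists r => //= s /= st.
have [->|sNt] := eqVneq s t; first by rewrite !subrr scale0r subr0 !normr0 mulr0.
have st0 : s - t != 0 by rewrite subr_eq0.
have st' : `|s - t| < r by rewrite distrC.
have := hr (s - t); rewrite /= sub0r normrN => /(_ st' st0).
rewrite [(s - t) *: 1]mulr1 subrK => h.
have -> : f s - f t - (s - t) *: d =
    - ((s - t) *: (d - (s - t)^-1 *: (f s - f t))).
  by rewrite scalerBr opprB scalerA mulfV// scale1r.
by rewrite normrN normrZ mulrC ler_wpM2r.
Qed.

Lemma near_is_derive f t (d : V) :
  (forall e, 0 < e ->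
     \forall s \near t, `|f s - f t - (s - t) *: d| <= e * `|s - t|) ->
  is_derive t 1 f d.
Proof.
move=> fd.
have h : h^-1 *: ((f \o shift t) (h *: 1) - f t) @[h --> 0^'] --> d.
  apply/cvgrPdist_le => e e0; have [r /= r0 hr] := fd _ e0.
  exists r => //= h /=; rewrite sub0r normrN => hlt h0.
  have := hr (h + t); rewrite /= opprD addrCA subrr addr0 normrN => /(_ hlt).
  rewrite addrK [h *: 1]mulr1 => {}hr.
  have -> : d - h^-1 *: (f (h + t) - f t) =
      - (h^-1 *: (f (h + t) - f t - h *: d)).
    by rewrite [in RHS]scalerBr opprB scalerA mulVf// scale1r.
  by rewrite normrN normrZ normfV mulrC ler_pdivrMr// normr_gt0.
have dh : derivable f t 1 by apply/cvg_ex; exists d.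
by apply: DeriveDef => //; exact: cvg_lim h.
Qed.

End first_order.

Section null_variation.
Context {R : realType}.
Notation mu := (@lebesgue_measure R).

(* Every increment of f based at a point of the null set N is dominated by that of
   a monotone function of total variation at most e. *)
Definition null_variation {V : normedModType R} (f : R -> V) : Prop :=
  forall (b : R) (N : set R) (e : R), mu.-negligible N -> 0 < e ->
  exists G : R -> R, [/\ {homo G : s t / s <= t}, forall r, 0 <= G r <= e &
    forall t, N t -> 0 <= t <= b ->
      \forall s \near t, `|f s - f t| <= `|G s - G t| ].

(** A single point is a null set, and [G] oscillates by at most [e]. *)
Lemma null_variation_continuous {V : normedModType R} (f : R -> V) t :
  null_variation f -> 0 <= t -> {for t, continuous f}.
Proof.
move=> nvf t0; apply/cvgrPdist_le => e e0.
have [|G [G1 G2 /(_ t erefl)]] := nvf t [set t] e _ e0.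
  by exists [set t]; split => //; rewrite lebesgue_measure_set1.
rewrite t0 lexx => /(_ isT); apply: filterS => s h.
rewrite distrC (le_trans h)//.
have /andP[? ?] := G2 s; have /andP[? ?] := G2 t.
by rewrite ler_norml; apply/andP; split; lra.
Qed.

(** The closure properties below reduce to this transfer of increments. The dominating function is
    [K * (G1 + G2)]; its smallness uses [K + 1] because [K] may vanish. *)
Lemma null_variation_le2 {V1 V2 W : normedModType R}
    (f1 : R -> V1) (f2 : R -> V2) (g : R -> W) :
  null_variation f1 -> null_variation f2 ->
  (forall b : R, exists2 K : R, 0 <= K & forall t : R, 0 <= t <= b -> \forall s \near t,
     `|g s - g t| <= K * (`|f1 s - f1 t| + `|f2 s - f2 t|)) ->
  null_variation g.
Proof.
move=> nv1 nv2 Kg b N e N0 e0; have [K K0 gK] := Kg b.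
pose e' := e / (2 * (K + 1)).
have e'0 : 0 < e' by rewrite divr_gt0// mulr_gt0// ltr_wpDl.
have [G1 [homo1 b1 h1]] := nv1 b N e' N0 e'0.
have [G2 [homo2 b2 h2]] := nv2 b N e' N0 e'0.
exists (fun r => K * (G1 r + G2 r)); split.
- by move=> s t st; rewrite ler_wpM2l// lerD// ?homo1 ?homo2.
- move=> r; have /andP[? ?] := b1 r; have /andP[? ?] := b2 r.
  rewrite mulr_ge0 ?addr_ge0//=.
  apply: (@le_trans _ _ (K * (e' + e'))).
    by rewrite ler_wpM2l// lerD.
  have -> : K * (e' + e') = e * (K / (K + 1)).
    by rewrite /e'; field; rewrite gt_eqF// ltr_wpDl.
  by rewrite ler_piMr// ?(ltW e0)// ler_pdivrMr ?ltr_wpDl// mul1r lerDl.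
- move=> t Nt tb.
  have := gK t tb; have := h2 t Nt tb; have := h1 t Nt tb.
  apply: filterS3 => s H1 H2 H3.
  apply: (le_trans H3); rewrite -mulrBr normrM (ger0_norm K0) ler_wpM2l//.
  apply: (le_trans (lerD H1 H2)).
  have [st|/ltW st] := leP s t.
    have := homo1 _ _ st; have := homo2 _ _ st => ? ?.
    by rewrite !ler0_norm; lra.
  have := homo1 _ _ st; have := homo2 _ _ st => ? ?.
  by rewrite !ger0_norm; lra.
Qed.

(** [F] may jump. At the supremum [c] of [A], the left half of the local condition puts [c] in [A],
    and the right half moves past [c] unless [c = t]. *)
Lemma locally_nondecreasing (F : R -> R) s t : s <= t ->
  (forall r : R, s <= r <= t -> \forall r' \near r,
     (r <= r' -> F r <= F r') /\ (r' <= r -> F r' <= F r)) ->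
  F s <= F t.
Proof.
move=> st locF; pose A := [set r | s <= r <= t /\ F s <= F r].
have As : A s by rewrite /A /= lexx.
have supA : has_sup A.
  by split; [exists s|exists t => r [/andP[]]].
pose c := sup A.
have sc : s <= c by exact: sup_upper_bound.
have ct : c <= t by apply: ge_sup; [exists s|move=> r [/andP[]]].
have [d /= d0 dc] := locF c (introT andP (conj sc ct)).
have Ac : A c.
  have [r Ar rc] := sup_adherent d0 supA.
  have rc' : r <= c by exact: sup_upper_bound.
  case: (Ar) => /andP[sr rt] Fsr.
  split; first by rewrite sc.
  apply: (le_trans Fsr); apply: (dc r _).2 => //=.
  by rewrite ger0_norm ?subr_ge0// ltrBlDl -ltrBlDr.
have [<-|cNt] := eqVneq c t; first by case: Ac.
have clt : c < t by rewrite lt_neqAle cNt.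
pose r := Num.min (c + d / 2) t.
have cr : c < r by rewrite /r lt_min clt andbT ltrDl divr_gt0.
have Ar : A r.
  split; first by rewrite (le_trans sc (ltW cr)) /r ge_min lexx orbT.
  case: Ac => _ /le_trans; apply; apply: (dc r _).1; last exact: ltW.
  rewrite /= ler0_norm ?subr_le0 ?(ltW cr)// opprB ltrBlDl /r.
  by rewrite gt_min ltrD2l; apply/orP; left; lra.
by have := sup_upper_bound supA Ar; rewrite leNgt cr.
Qed.

(* Adding e t and the monotone function of [null_variation] for the exceptional set
   makes f locally nondecreasing at every point. *)
Lemma null_variation_le (f : R -> R) s t :
  null_variation (f : R -> R^o) -> 0 <= s -> s <= t ->
  {ae mu, forall r : R, s <= r <= t ->
    exists2 d, is_derive r 1 (f : R -> R^o) d & 0 <= d} ->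
  f s <= f t.
Proof.
move=> nvf s0 st aef; apply/ler_addgt0Pr => e e0.
pose N := ~` [set r : R | s <= r <= t ->
  exists2 d, is_derive r 1 (f : R -> R^o) d & 0 <= d].
(* The slope costs [e' * (t - s)] and [G] at most [e'], together [e]. *)
pose e' := e / (1 + (t - s)).
have ts0 : 0 < 1 + (t - s) by rewrite ltr_pwDl// subr_ge0.
have e'0 : 0 < e' by rewrite divr_gt0.
have [G [homoG Gb hG]] := nvf t N e' aef e'0.
have : f s + e' * s + G s <= f t + e' * t + G t.
  apply: (@locally_nondecreasing (fun r => f r + e' * r + G r)) => // r srt.
  have /andP[sr rt] := srt.
  have r0 : 0 <= r := le_trans s0 sr.
  have [Nr|nNr] := pselect (N r).
    have := hG r Nr; rewrite r0 rt => /(_ isT); apply: filterS => r'.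
    move=> h; split => rr'.
      have Grr := homoG _ _ rr'.
      rewrite (ger0_norm (_ : 0 <= G r' - G r)) ?subr_ge0// in h.
      have : e' * r <= e' * r' by rewrite ler_wpM2l// ltW.
      by move: h; rewrite ler_norml => /andP[]; lra.
    have Grr := homoG _ _ rr'.
    rewrite (ler0_norm (_ : G r' - G r <= 0)) ?subr_le0// in h.
    have : e' * r' <= e' * r by rewrite ler_wpM2l// ltW.
    by move: h; rewrite ler_norml => /andP[]; lra.
  have [d fd d0] : exists2 d, is_derive r 1 (f : R -> R^o) d & 0 <= d.
    by apply: contrapT => h; apply: nNr => /(_ srt).
  have := is_derive_near fd e'0; apply: filterS => r' h; split => rr'.
    have := homoG _ _ rr' => ?; rewrite (ger0_norm (_ : 0 <= r' - r)) ?subr_ge0// in h.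
    have : 0 <= (r' - r) * d by rewrite mulr_ge0// subr_ge0.
    move: h; rewrite ler_norml => /andP[]; rewrite /GRing.scale/=; lra.
  have := homoG _ _ rr' => ?; rewrite (ler0_norm (_ : r' - r <= 0)) ?subr_le0// in h.
  have : 0 <= (r - r') * d by rewrite mulr_ge0// subr_ge0.
  move: h; rewrite ler_norml => /andP[]; rewrite /GRing.scale/=; lra.
have /andP[? ?] := Gb s; have /andP[? ?] := Gb t.
have : e' * (1 + (t - s)) = e by rewrite /e' divfK// gt_eqF.
lra.
Qed.

Lemma null_variation_nondecreasing (f : R -> R) :
  null_variation (f : R -> R^o) ->
  {ae mu, forall t : R, 0 <= t ->
    exists2 d, is_derive t 1 (f : R -> R^o) d & 0 <= d} ->
  forall s t, 0 <= s -> s <= t -> f s <= f t.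
Proof.
move=> nvf aef s t s0 st; apply: null_variation_le => //.
apply: (@filterS _ _ (ae_filter_ringOfSetsType mu)) aef => r h /andP[sr _].
exact/h/(le_trans s0).
Qed.

End null_variation.

(** * From domination by an integral to null variation *)

Section domination_null_variation.
Context {R : realType}.
Notation mu := (@lebesgue_measure R).

(** Absolute continuity of the integral joined to outer regularity: the part of [m] above a level
    [n] has integral at most [e / 2], and the rest is at most [n] on an open set of measure at most
    [e / 2 / (n + 1)]. *)
Lemma open_small_integral (m : R -> R) (N : set R) e :
  measurable_fun setT m -> (forall t, 0 <= m t) ->
  (\int[mu]_t (m t)%:E < +oo)%E -> mu.-negligible N -> 0 < e ->
  exists U, [/\ open U, N `<=` U & (\int[mu]_(t in U) (m t)%:E <= e%:E)%E].
Proof.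
move=> mm m0 intm [A [mA A0 NA]] e0.
have im : mu.-integrable setT (EFin \o m).
  apply/integrableP; split; first exact/measurable_EFinP.
  by under eq_integral do rewrite /= ger0_norm//.
pose r n t := m t - Num.min (m t) n%:R.
have mr n : measurable_fun setT (r n).
  by apply: measurable_funB => //; exact: measurable_minr.
have r0 n t : 0 <= r n t by rewrite /r subr_ge0 ge_min lexx.
have cr : (\int[mu]_t (r n t)%:E @[n --> \oo] --> 0)%E.
  rewrite -(@integral0 _ _ _ mu setT).
  apply: (@dominated_cvg _ _ _ mu _ _ (fun n => EFin \o r n) _ (EFin \o m)) => //.
  - by move=> n; apply/measurable_EFinP; exact: mr.
  - move=> t _; apply: cvg_near_cst; near=> n; rewrite /r /= min_l ?subrr//.
    by near: n; exact: nbhs_infty_ger.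
  - move=> n t _ /=; rewrite lee_fin ger0_norm//.
    by rewrite /r lerBlDr lerDl le_min m0 ler0n.
have [n rn] : exists n, (\int[mu]_t (r n t)%:E <= (e / 2)%:E)%E.
  have /fine_cvgP[h1 /cvgrPdist_le /(_ (e / 2)) h2] := cr.
  have {}h2 := h2 (divr_gt0 e0 (ltr0Sn _ 1)).
  near \oo => n; exists n.
  have h3 : (\int[mu]_t (r n t)%:E)%E \is a fin_num by near: n.
  rewrite -(fineK h3) lee_fin.
  have : `|0 - fine (\int[mu]_t (r n t)%:E)%E| <= e / 2 by near: n.
  by rewrite sub0r normrN ger0_norm// fine_ge0// integral_ge0// => t _; rewrite lee_fin.
pose d := e / 2 / (n%:R + 1).
have n1 : 0 < n%:R + 1 :> R by rewrite ltr_wpDl.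
have d0 : 0 < d by rewrite !divr_gt0.
have Afin : (mu A < +oo)%E by rewrite A0 ltry.
have [U [oU AU Ud]] := lebesgue_regularity_outer mA Afin d0.
exists U; split => //; first exact: subset_trans AU.
have mU : measurable U by exact: open_measurable.
have muU : (mu U <= d%:E)%E.
  have UA0 : mu (U `&` A) = 0%E.
    apply/eqP; rewrite eq_le measure_ge0 andbT -A0 le_measure// inE//.
    exact: measurableI.
  have -> : mu U = (mu (U `\` A) + mu (U `&` A))%E by exact: measureDI.
  by rewrite UA0 adde0 ltW.
apply: (@le_trans _ _ (\int[mu]_(t in U) ((r n t)%:E + n%:R%:E))%E).
  apply: ge0_lower_integral_le => [//|t _|t _].
    rewrite -EFinD !lee_fin m0 /= /r.
    by have := ge_min n%:R (m t) n%:R; rewrite lexx orbT; lra.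
  by rewrite -EFinD lee_fin; apply: addr_ge0.
rewrite ge0_integralD//; first last.
- by apply/measurable_EFinP; exact: measurable_funTS (mr n).
- by move=> t _; rewrite lee_fin.
rewrite [e in leRHS]splitr EFinD; apply: leeD.
  apply: le_trans rn; apply: ge0_lower_integral_le => [//|t _|t _].
    by rewrite lexx lee_fin r0.
  by rewrite lee_fin.
rewrite integral_cst//; apply: (@le_trans _ _ (n%:R%:E * d%:E)%E).
  by rewrite lee_wpmul2l// lee_fin.
rewrite -EFinM lee_fin /d mulrCA ler_piMr ?ltW ?divr_gt0//.
by rewrite ltr_pdivrMr// mul1r ltrDl.
Unshelve. all: by end_near. Qed.

(** [G] is the integral of [m] over [U] up to time [r], where [U] is an open neighbourhood of [N]
    with small integral. Near a point of [N] the interval between the two times lies in [U], so the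
    increment of [G] is at least the dominating integral. *)
Lemma dominated_null_variation {V : normedModType R} (f : R -> V) :
  (forall t, t <= 0 -> f t = f 0) ->
  (forall b, 0 < b -> exists m : R -> R, [/\ measurable_fun setT m,
    forall t, 0 <= m t, (\int[mu]_t (m t)%:E < +oo)%E &
    forall a c, 0 <= a -> a <= c -> c <= b ->
    (`|f c - f a|%:E <= \int[mu]_(t in `]a, c]) (m t)%:E)%E]) ->
  null_variation f.
Proof.
move=> f0 dom b N e N0 e0.
(* The margin 1 leaves room for times beyond [b]. *)
have b1 : 0 < Num.max b 0 + 1 by rewrite ltr_wpDl// le_max lexx orbT.
have [m [mm m0 intm fm]] := dom _ b1.
have [U [oU NU intU]] := open_small_integral mm m0 intm N0 e0.
have mU : measurable U by exact: open_measurable.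
pose I r := (\int[mu]_(t in U `&` `]-oo, r]) (m t)%:E)%E.
have mI (r : R) : measurable (U `&` `]-oo, r]) by exact: measurableI.
have mE (A : set R) : measurable_fun A (EFin \o m).
  by apply/measurable_EFinP; exact: measurable_funTS.
have I0 r : (0 <= I r)%E by apply: integral_ge0 => t _; rewrite lee_fin.
have Ie r : (I r <= e%:E)%E.
  apply: le_trans intU; apply: ge0_lower_integral_le => [t []//|t _|t _].
    by rewrite lexx lee_fin m0.
  by rewrite lee_fin.
have Ifin r : I r \is a fin_num.
  by rewrite ge0_fin_numE// (le_lt_trans (Ie r)) ?ltry.
have homoI s t : s <= t -> (I s <= I t)%E.
  move=> st; apply: ge0_lower_integral_le => [r [Ur]|r _|r _].
  - by rewrite /= !in_itv/= => rs; split=> //; exact: le_trans rs st.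
  - by rewrite lexx lee_fin m0.
  - by rewrite lee_fin.
exists (fine \o I); split.
- by move=> s t st /=; rewrite fine_le// homoI.
- by move=> r /=; rewrite fine_ge0//= -lee_fin fineK.
move=> t Nt /andP[t0 tb].
have key a c : 0 <= a -> a <= c -> c <= Num.max b 0 + 1 -> `]a, c]%classic `<=` U ->
    `|f c - f a| <= fine (I c) - fine (I a).
  move=> a0 ac cb acU; rewrite -lee_fin EFinB !fineK//.
  apply: le_trans (fm a c a0 ac cb) _.
  rewrite leeBrDr// addeC /I -ge0_integral_setU//.
  - apply: ge0_lower_integral_le => [r [[Ur]|/= acr]|r _|r _].
    + by rewrite /= !in_itv/= => ra; split=> //; exact: le_trans ra ac.
    + split; first exact: acU.
      by move: acr; rewrite /= !in_itv/= => /andP[].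
    + by rewrite lexx lee_fin m0.
    + by rewrite lee_fin.
  - exact: mI.
  - exact: mE.
  - by move=> r _; rewrite lee_fin.
  - apply/disj_set2P/seteqP; split=> // r /= [[_]]; rewrite !in_itv/= => ra.
    by move=> /andP[]; rewrite ltNge ra.
have : nbhs t U by apply: open_nbhs_nbhs; split=> //; exact: NU.
move=> [d /= d0 dU].
exists (Num.min d 1) => /=; first by rewrite lt_min d0 ltr01.
move=> s /=; rewrite lt_min => /andP[sd s1].
have mb : b <= Num.max b 0 by rewrite le_max lexx.
have [ts|/ltW st] := leP t s.
  apply: le_trans (ler_norm _); apply: key => //.
    by move: s1; rewrite ltr_norml => /andP[]; lra.
  move=> r /=; rewrite in_itv/= => /andP[tr rs]; apply: dU => /=.
  by move: sd; rewrite !ltr_norml => /andP[? ?]; apply/andP; split; lra.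
rewrite distrC [leRHS]distrC; apply: le_trans (ler_norm _).
(* The domination holds at nonnegative times only; before 0 the curve is constant. *)
pose s0 := Num.max s 0.
have -> : f s = f s0.
  by rewrite /s0; case: (leP s 0) => [/f0|].
have s0t : s0 <= t by rewrite /s0 ge_max st.
have ss0 : s <= s0 by rewrite /s0 le_max lexx.
apply: (@le_trans _ _ (fine (I t) - fine (I s0))).
  apply: key => //.
  - by rewrite /s0 le_max lexx orbT.
  - by rewrite (le_trans tb)// (le_trans mb)// lerDl.
  move=> r /=; rewrite in_itv/= => /andP[tr rs]; apply: dU => /=.
  by move: sd; rewrite !ltr_norml => /andP[? ?]; apply/andP; split; lra.
by rewrite lerD2l lerN2 fine_le// homoI.
Qed.

End domination_null_variation.

(** * Primitives and lower integrals *)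

Section primitives.
Context {R : realType}.
Notation mu := (@lebesgue_measure R).
Implicit Types (f g F : R -> R).

Lemma nondecreasing_bounded_cvg F (C : R) :
  (forall s t, 0 <= s -> s <= t -> F s <= F t) -> (forall t, 0 <= t -> F t <= C) ->
  exists2 l, F t @[t --> +oo] --> l & forall t, 0 <= t -> F t <= l.
Proof.
move=> ndF FC; pose G t := F (Num.max t 0).
have G0 t : 0 <= t -> G t = F t by move=> t0; rewrite /G max_l.
have ndG : {homo G : s t / s <= t}.
  move=> s t st; apply: ndF; first by rewrite le_max lexx orbT.
  by rewrite ge_max le_max st/= le_max lexx orbT.
have ubG : has_ubound (range G).
  by exists C => _ [t _ <-]; apply: FC; rewrite le_max lexx orbT.
exists (sup (range G)); last first.
  by move=> t t0; rewrite -G0//; apply: sup_upper_bound; [split => //; exists (G 0), 0|exists t].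
apply: cvg_trans (nondecreasing_cvgr ndG ubG); apply: near_eq_cvg.
by near=> t; rewrite G0//; near: t; exact: nbhs_pinfty_ge.
Unshelve. all: by end_near. Qed.

Lemma ae_neq0 : {ae mu, forall t : R, t != 0}.
Proof.
exists [set 0]; split => //; first by rewrite lebesgue_measure_set1.
by move=> t /= /negP; rewrite negbK => /eqP.
Qed.

Lemma lebesgue_measure_itv_lty (u v : bool) (p q : R) :
  (mu [set` Interval (BSide u p) (BSide v q)] < +oo)%E.
Proof. by rewrite lebesgue_measure_itv/=; case: ifP => // _; rewrite ltry. Qed.

Lemma lebesgue_measure_itv_oc (a c : R) : a <= c -> mu `]a, c] = (c - a)%:E.
Proof.
move=> ac; rewrite lebesgue_measure_itv/= lte_fin; case: ltP => // ca.
by rewrite (le_anti (introT andP (conj ac ca))) subrr.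
Qed.

(** Time frozen at 0: the standard of comparison for Lipschitz curves, and the linear term of later
    monotone quantities. *)
Lemma null_variation_clip : null_variation (fun t : R => Num.max t 0 : R^o).
Proof.
apply: dominated_null_variation.
  by move=> t t0; rewrite maxxx max_r.
move=> b b0; exists (\1_(`[0, b]%classic) : R -> R); split => //.
- by rewrite integral_indic// setIT; exact: lebesgue_measure_itv_lty.
- move=> a c a0 ac cb; rewrite integral_indic// setIidr; last first.
    move=> t /=; rewrite !in_itv/= => /andP[/ltW at_ tc].
    by rewrite (le_trans a0 at_) (le_trans tc cb).
  rewrite !max_l ?(le_trans a0)// ger0_norm ?subr_ge0//.
  by rewrite -lebesgue_measure_itv_oc.
Qed.

Lemma null_variation_lipschitz {V : normedModType R} (f : R -> V) :
  (forall b : R, exists2 K : R, 0 <= K & forall t : R, 0 <= t <= b -> \forall s \near t,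
     `|f s - f t| <= K * `|Num.max s 0 - Num.max t 0|) ->
  null_variation f.
Proof.
move=> lipf; apply: (null_variation_le2 null_variation_clip null_variation_clip).
move=> b; have [K K0 fK] := lipf b; exists K => // t tb.
by move: (fK t tb); apply: filterS => s /le_trans; apply; rewrite ler_wpM2l// lerDl.
Qed.

Definition prim g (t : R) : R := \int[mu]_(r in `[0, t]) g r.

Section prim.
Variable g : R -> R.
Hypotheses (mg : measurable_fun setT g) (g0 : forall t, 0 <= g t).
Hypothesis (bg : forall b, exists K, forall t, `|t| <= b -> g t <= K).

Lemma prim_integrable y : mu.-integrable `[0, y] (EFin \o g).
Proof.
apply: measurable_bounded_integrable => //.
- exact: lebesgue_measure_itv_lty.
- exact: measurable_funTS.
have [K gK] := bg `|y|.
exists K; split; first exact: num_real.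
move=> M KM t /=; rewrite in_itv/= => /andP[t0 ty].
rewrite ger0_norm// (le_trans (gK t _)) ?(ltW KM)//.
by rewrite !ger0_norm// (le_trans t0).
Qed.

Lemma prim_locally_integrable : locally_integrable setT g.
Proof.
split => //; first exact: openT.
move=> K _ cK; have [M [Mr KM]] := compact_bounded cK.
have [C gC] := bg (M + 1).
have M1 : M < M + 1 by rewrite ltrDl.
apply: (@le_lt_trans _ _ (\int[mu]_(t in [set` `[- (M + 1), M + 1]%R]) (`|C|%:E))%E).
  apply: ge0_lower_integral_le => [t Kt|t Kt|//].
  - by have /= := KM _ M1 _ Kt; rewrite ler_norml in_itv.
  - rewrite !lee_fin normr_ge0/= ger0_norm// (le_trans (gC t _)) ?ler_norm//.
    exact: KM M1 _ Kt.
rewrite integral_cst// lte_mul_pinfty//.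
exact: lebesgue_measure_itv_lty.
Qed.

Lemma prim_le0 t : t <= 0 -> prim g t = 0.
Proof.
rewrite /prim le_eqVlt => /predU1P[->|t0].
  by rewrite set_itv1 Rintegral_set1.
by rewrite set_itv_ge ?Rintegral_set0// bnd_simp -ltNge.
Qed.

Lemma primB s t : 0 <= s -> s <= t ->
  ((prim g t - prim g s)%:E = \int[mu]_(r in `]s, t]) (g r)%:E)%E.
Proof.
move=> s0 st; rewrite /prim Rintegral_itvB ?bnd_simp//; last exact: prim_integrable.
rewrite fineK//; apply: integrable_fin_num => //.
apply: integrableS (prim_integrable t) => // r /=.
by rewrite !in_itv/= => /andP[/ltW sr ->]; rewrite (le_trans s0).
Qed.

Lemma prim_nondecreasing s t : 0 <= s -> s <= t -> prim g s <= prim g t.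
Proof.
move=> s0 st; rewrite -subr_ge0 -lee_fin primB// integral_ge0// => r _.
by rewrite lee_fin.
Qed.

Lemma prim_ge0 t : 0 <= prim g t.
Proof.
have [t0|/ltW t0] := leP 0 t; last by rewrite prim_le0.
by rewrite -(prim_le0 (lexx 0)); exact: prim_nondecreasing.
Qed.

Lemma primE t : 0 <= t ->
  ((prim g t)%:E = \int[mu]_(r in `[0%R, t]) (g r)%:E)%E.
Proof. by move=> t0; rewrite fineK// integrable_fin_num//; exact: prim_integrable. Qed.

Lemma null_variation_prim : null_variation (prim g : R -> R^o).
Proof.
apply: dominated_null_variation.
  by move=> t t0; rewrite !prim_le0.
move=> b b0; pose m := g \_ `[0, b]; exists m.
have mE (A : set R) : (\int[mu]_(t in A) (m t)%:E =
    \int[mu]_(t in A `&` `[0%R, b]) (g t)%:E)%E.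
  by rewrite integral_mkcondr; apply: eq_integral => t _; rewrite /m /= !patchE; case: ifP.
split.
- by apply/(measurable_restrictT _ _).1 => //; exact: measurable_funTS.
- by move=> t; rewrite /m patchE; case: ifP.
- by rewrite mE setTI -primE ?(ltW b0)// ltry.
- move=> a c a0 ac cb; rewrite ger0_norm ?subr_ge0 ?prim_nondecreasing// primB//.
  rewrite mE setIidl// => t /=; rewrite !in_itv/= => /andP[/ltW at_ tc].
  by rewrite (le_trans a0 at_) (le_trans tc cb).
Qed.

Lemma prim_is_derive : {ae mu, forall t : R, 0 <= t ->
  is_derive t 1 (prim g : R -> R^o) (g t)}.
Proof.
have := @FTC1 _ g (BLeft 0) prim_integrable prim_locally_integrable.
(* The time 0 is discarded: the primitive vanishes before 0 and may have a corner there. *)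
move: ae_neq0; apply: (@filterS2 _ _ (ae_filter_ringOfSetsType mu)) => t /= tN0 h t0.
have [] := h _; first by rewrite lte_fin lt_neqAle eq_sym tN0.
rewrite derive1E => d1 d2; exact: DeriveDef.
Qed.

End prim.

(* The integral is a supremum over simple minorants h of g, so g need not be
   measurable: F is compared with the primitive of each h. *)
Lemma lower_integral_le_increment F g (C : R) :
  null_variation (F : R -> R^o) -> (forall t, 0 <= t -> 0 <= g t) ->
  {ae mu, forall t : R, 0 <= t ->
    exists2 d, is_derive t 1 (F : R -> R^o) d & g t <= d} ->
  (forall t, 0 <= t -> F t - F 0 <= C) ->
  (\int[mu]_(t in `[0%R, +oo[) (g t)%:E <= C%:E)%E.
Proof.
move=> nvF g0 dF FC.
rewrite ge0_integralE; last by move=> t /=; rewrite in_itv/= andbT lee_fin => /g0.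
apply: ge_ereal_sup => _ [h /= hg <-].
have h0 t : 0 <= h t by exact: fun_ge0.
have hle t : 0 <= t -> h t <= g t.
  by move=> t0; have := hg t; rewrite patchE mem_set//= in_itv/= t0.
have hN t : t < 0 -> h t = 0.
  move=> t0; have := hg t; rewrite patchE memNset/=; last first.
    by rewrite in_itv/= lt_geF.
  by rewrite lee_fin => ht; apply/le_anti; rewrite ht h0.
have mh : measurable_fun setT h by [].
have bh : forall b : R, exists K, forall t, `|t| <= b -> h t <= K.
  move=> b; have [M [_ hM]] := simple_bounded h; exists (M + 1) => t _.
  rewrite (le_trans (ler_norm _))//; apply: hM => //.
  by rewrite ltrDl.
rewrite -integralT_nnsfun.
have -> : (\int[mu]_t (h t)%:E = \int[mu]_(t in `[0%R, +oo[) (h t)%:E)%E.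
  rewrite [RHS]integral_mkcond; apply: eq_integral => t _; rewrite patchE.
  by case: ifPn => // /negP; rewrite inE/= in_itv/= andbT => /negP; rewrite -ltNge => /hN ->.
apply: (cvge_to_le (ge0_cvgn_integral h0 mh)); apply: nearW => n.
rewrite -primE// lee_fin.
have key : F 0 - prim h 0 <= F n%:R - prim h n%:R.
  apply: (@null_variation_nondecreasing _ (fun t => F t - prim h t)) => //.
    apply: (null_variation_le2 nvF (null_variation_prim mh h0 bh)).
    move=> b; exists 1 => // t _; apply: (@nearW _ (nbhs t)) => s; rewrite mul1r.
    by rewrite opprD addrACA -opprD; exact: ler_normB.
  have := prim_is_derive mh h0 bh; move: dF;
  apply: (@filterS2 _ _ (ae_filter_ringOfSetsType mu)) => t h1 h2 t0.
  have [d Fd gd] := h1 t0; have hd := h2 t0.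
  exists (d - h t); last by rewrite subr_ge0 (le_trans (hle _ t0)).
  exact: is_deriveB.
have := FC n%:R (ler0n _ _); rewrite prim_le0// in key; lra.
Qed.

End primitives.

(** * Strong measurability of derivatives *)

Section strong_measurability.
Context {R : realType} {V : normedModType R}.
Notation mu := (@lebesgue_measure R).

Lemma segment_unif_continuous (phi : R -> V) (b e : R) : continuous phi -> 0 < e ->
  exists2 d, 0 < d & forall t s, 0 <= t <= b -> `|t - s| < d ->
    `|phi t - phi s| <= e.
Proof.
move=> cphi e0; have e20 : 0 < e / 2 by rewrite divr_gt0.
have cpt : compact `[0, b]%classic by exact: segment_compact.
have := (compact_near_coveringP _).1 cpt R (0^'+)
  (fun d t => forall s, `|t - s| < d -> `|phi t - phi s| <= e) _.
move=> /(_ _)[].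
  move=> x xb; have /cvgrPdist_le /(_ _ e20) [r /= r0 rx] := cphi x.
  have r20 : 0 < r / 2 by rewrite divr_gt0.
  exists ([set t | `|x - t| < r / 2], [set d : R | d < r / 2]) => /=.
    split; first by exists (r / 2).
    by exists (r / 2) => //= d /=; rewrite sub0r normrN => /(le_lt_trans (ler_norm _)).
  move=> [t d] /= [xt dr] s ts.
  rewrite -(subrKA (phi x)) (le_trans (ler_normD _ _))// (splitr e) lerD//.
    rewrite distrC; apply: rx => /=.
    by apply: lt_le_trans xt _; lra.
  apply: rx => /=; rewrite -(subrKA t) (le_lt_trans (ler_normD _ _))//.
  by rewrite (splitr r) ltrD// (lt_trans ts).
move=> d /= d0 hd; exists (d / 2); first by rewrite divr_gt0.
move=> t s tb ts; apply: (hd (d / 2)) => //=.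
- rewrite sub0r normrN gtr0_norm ?divr_gt0//.
  by move: d0; lra.
- by rewrite divr_gt0.
Qed.

Lemma simple_fun_approx (phi : R -> V) (b e : R) : continuous phi -> 0 < e ->
  exists s : simple_fun, forall t, 0 <= t <= b -> `|phi t - sf_eval s t| <= e.
Proof.
move=> cphi e0; have [d d0 hd] := segment_unif_continuous b cphi e0.
(* Half-open cells of length [d], enough of them to cover [b]. The cell of [t] is numbered by the
   integer part of [t / d], and [phi] is sampled at its left end. *)
pose n := (Num.truncn (b / d)).+1.
pose A (i : 'I_n) : set R := `[i%:R * d, i.+1%:R * d[%classic.
have mA i : measurable (A i) by exact: measurable_itv.
have fA i : (mu (A i) < +oo)%E by exact: lebesgue_measure_itv_lty.
exists (SimpleFun (fun i : 'I_n => phi (i%:R * d)) mA fA) => t tb.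
have /andP[t0 tlb] := tb.
have td0 : 0 <= t / d by rewrite divr_ge0// ltW.
have kn : (Num.truncn (t / d) < n)%N.
  by rewrite ltnS le_truncn// ler_pM2r// invr_gt0.
pose k := Ordinal kn.
have /andP[k1 k2] := truncn_itv td0.
have kt : k%:R * d <= t by rewrite -ler_pdivlMr.
have tk : t < k.+1%:R * d by rewrite -ltr_pdivrMr.
rewrite /sf_eval /= (bigD1 k)//= big1 ?addr0.
  rewrite indicE mem_set /A /= ?in_itv/= ?kt ?tk// scale1r.
  apply: hd => //; rewrite ger0_norm ?subr_ge0//.
  by move: tk; rewrite -natr1 mulrDl mul1r; lra.
move=> i ik; rewrite indicE memNset ?scale0r// /A /= in_itv/= => /andP[it ti].
move/eqP : ik; apply; apply/val_inj => /=; apply/esym; apply: truncn_def.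
by rewrite ler_pdivlMr// ltr_pdivrMr// it.
Qed.

(** The [n]-th function is replaced on [[0, n]] by a simple one within [1 / (n + 1)]; a given time
    lies in all but finitely many of these segments. *)
Lemma strongly_measurable_lim (phi : nat -> R -> V) (f : R -> V) :
  (forall n, continuous (phi n)) ->
  {ae mu, forall t : R, 0 <= t -> phi n t @[n --> \oo] --> f t} ->
  strongly_measurable `[0, +oo[ f.
Proof.
move=> cphi phif.
have h n : exists s : simple_fun, forall t, 0 <= t <= n%:R ->
    `|phi n t - sf_eval s t| <= n.+1%:R^-1.
  by apply: simple_fun_approx => //; rewrite invr_gt0.
exists (fun n => sval (cid (h n))).
apply: (@filterS _ _ (ae_filter_ringOfSetsType mu)) phif => t phit /=.
rewrite in_itv/= andbT => t0.
have := phit t0 => /cvgrPdist_le ft.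
apply/cvgrPdist_le => e e0; have e20 : 0 < e / 2 by rewrite divr_gt0.
near=> n; rewrite -(subrKA (phi n t)) (le_trans (ler_normD _ _))// (splitr e) lerD//.
  by near: n; exact: ft.
apply: (@le_trans _ _ n.+1%:R^-1).
  apply: (svalP (cid (h n))); rewrite t0/=; near: n; exact: nbhs_infty_ger.
by apply: ltW; near: n; exact: (near_infty_natSinv_lt (PosNum e20)).
Unshelve. all: by end_near. Qed.

End strong_measurability.

(** * Hilbert spaces: projection, weak limits, Opial *)

Section inner_theory.
Context {R : realType} {H : hilbertType R}.
Implicit Types x y z w : H.

Lemma innerDr x y z : inner x (y + z) = inner x y + inner x z.
Proof. by rewrite innerC innerDl !(innerC x). Qed.

Lemma innerZr (a : R) x y : inner x (a *: y) = a * inner x y.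
Proof. by rewrite innerC innerZl innerC. Qed.

Lemma innerNl x y : inner (- x) y = - inner x y.
Proof. by rewrite -scaleN1r innerZl mulN1r. Qed.

Lemma innerNr x y : inner x (- y) = - inner x y.
Proof. by rewrite innerC innerNl innerC. Qed.

Lemma innerBl x y z : inner (x - y) z = inner x z - inner y z.
Proof. by rewrite innerDl innerNl. Qed.

Lemma innerBr x y z : inner x (y - z) = inner x y - inner x z.
Proof. by rewrite innerDr innerNr. Qed.

Lemma inner0l x : inner 0 x = 0.
Proof. by rewrite -(scale0r (0 : H)) innerZl mul0r. Qed.

Lemma inner0r x : inner x 0 = 0.
Proof. by rewrite innerC inner0l. Qed.

Definition innerE :=
  (@innerDl R H, innerDr, innerNl, innerNr, @innerZl R H, innerZr, inner0l, inner0r).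

Lemma sqr_norm x : `|x| ^+ 2 = inner x x.
Proof. by rewrite norm_inner sqr_sqrtr// inner_ge0. Qed.

Lemma inner_eq0 x : inner x x <= 0 -> x = 0.
Proof.
move=> xx; apply/normr0_eq0/eqP; rewrite -sqrf_eq0 sqr_norm.
by rewrite eq_le xx inner_ge0.
Qed.

Lemma inner_le_norm x y : inner x y <= `|x| * `|y|.
Proof.
have [->|y0] := eqVneq y 0; first by rewrite inner0r normr0 mulr0.
have ny0 : 0 < `|y| by rewrite normr_gt0.
have := inner_ge0 (`|y| *: x - `|x| *: y).
rewrite !innerE (innerC y x) -!sqr_norm => h.
have {}h : 0 <= 2 * (`|x| * `|y|) * (`|x| * `|y| - inner x y).
  by apply: le_trans h _; rewrite le_eqVlt; apply/orP; left; apply/eqP; ring.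
have [->|x0] := eqVneq x 0; first by rewrite inner0l normr0 mul0r.
move: h; rewrite pmulr_rge0 ?subr_ge0// !mulr_gt0// normr_gt0//.
Qed.

Lemma norm_inner_le x y : `|inner x y| <= `|x| * `|y|.
Proof.
by rewrite ler_norml inner_le_norm andbT lerNl -innerNl -(normrN x) inner_le_norm.
Qed.

Lemma norm_innerB_le x y z w :
  `|inner x y - inner z w| <= `|x| * `|y - w| + `|w| * `|x - z|.
Proof.
have -> : inner x y - inner z w = inner x (y - w) + inner (x - z) w.
  by rewrite !innerE; ring.
by rewrite (le_trans (ler_normD _ _))// lerD ?norm_inner_le// mulrC norm_inner_le.
Qed.

Lemma cvg_inner {T} {F : set_system T} {FF : Filter F} (f g : T -> H) (a b : H) :
  f @ F --> a -> g @ F --> b -> inner (f t) (g t) @[t --> F] --> inner a b.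
Proof.
move=> fa gb; apply/cvgrPdist_le => e e0.
pose e' := Num.min 1 (e / (`|a| + `|b| + 1)).
have ab0 : 0 < `|a| + `|b| + 1 by rewrite ltr_wpDl// addr_ge0.
have e'0 : 0 < e' by rewrite lt_min ltr01 divr_gt0.
have h1 := (cvgrPdist_le _ _).1 fa _ e'0; have h2 := (cvgrPdist_le _ _).1 gb _ e'0.
near=> t.
have f1 : `|a - f t| <= e' by near: t; exact: h1.
have g1 : `|b - g t| <= e' by near: t; exact: h2.
rewrite (le_trans (norm_innerB_le _ _ _ _))//.
have gt1 : `|g t| <= `|b| + 1.
  rewrite -[X in `|X| <= _](subrK b) addrC (le_trans (ler_normD _ _))// lerD2l.
  by rewrite distrC (le_trans g1)// ge_min lexx.
apply: (@le_trans _ _ (`|a| * e' + (`|b| + 1) * e')).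
  by apply: lerD; [rewrite ler_wpM2l|rewrite ler_pM].
rewrite -mulrDl addrA -ler_pdivlMl// mulrC ge_min lexx orbT//.
Unshelve. all: by end_near. Qed.

Lemma cvgr_unique {T} {F : set_system T} {FF : ProperFilter F} (f : T -> R)
  (a b : R) : f t @[t --> F] --> a -> f t @[t --> F] --> b -> a = b.
Proof.
by move=> fa fb; rewrite -(cvg_lim (@Rhausdorff R) fa) (cvg_lim (@Rhausdorff R) fb).
Qed.

Definition convex_subset (C : set H) := forall x y (t : R), C x -> C y ->
  0 < t < 1 -> C (t *: x + (1 - t) *: y).

(* Minimizing |y|^2 - 2 L y over C gives both the Riesz representation (C = H) and
   the projection onto C (L = inner z). *)
Lemma quadratic_min (C : set H) (L : H -> R) (M : R) :
  closed C -> convex_subset C -> C !=set0 ->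
  (forall x y, L (x + y) = L x + L y) -> (forall (a : R) x, L (a *: x) = a * L x) ->
  (forall x, L x <= M * `|x|) ->
  exists2 c, C c & forall y, C y -> L (y - c) <= inner c (y - c).
Proof.
move=> clC cvxC [y0 Cy0] LD LZ LM.
pose q y := inner y y - 2 * L y.
pose Q := [set q y | y in C].
have infQ : has_inf Q.
  split; first by exists (q y0), y0.
  exists (- M ^+ 2) => _ [y _ <-]; rewrite /q -sqr_norm.
  have := sqr_ge0 (`|y| - M); have := LM y; rewrite sqrrB; lra.
pose m := inf Q.
have mq y : C y -> m <= q y by move=> Cy; apply: ge_inf infQ.2 _ _; exists y.
(* Parallelogram identity, with the midpoint of [a] and [b] tested against the infimum. *)
have par a b : C a -> C b -> `|a - b| ^+ 2 <= 2 * (q a - m) + 2 * (q b - m).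
  move=> Ca Cb; have h2 : 0 < (2^-1 : R) < 1 by apply/andP; split; lra.
  have := mq _ (cvxC _ _ 2^-1 Ca Cb h2).
  rewrite /q sqr_norm !innerE !LD !LZ (innerC b a).
  have -> : 1 - 2^-1 = 2^-1 :> R by lra.
  by lra.
pose B (e : R) := [set y | C y /\ q y <= m + e].
pose F := filter_from [set e : R | 0 < e] B.
have Bn0 e : 0 < e -> B e !=set0.
  move=> e0; have [_ [y Cy <-] qy] := inf_adherent e0 infQ.
  by exists y; split => //; exact: ltW.
have FF : ProperFilter F.
  apply: filter_from_proper; last by move=> e /Bn0.
  apply: filter_from_filter; first by exists 1 => /=.
  move=> e1 e2 /= e10 e20; exists (Num.min e1 e2); first by rewrite /= lt_min e10.
  move=> y [Cy]; rewrite /B addr_minr le_min => /andP[? ?]; by split.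
have cauchyF : cauchy F.
  apply: cauchy_exP => e e0.
  (* Two elements of [B d] are then at squared distance at most [4 * d = e ^+ 2 / 2]. *)
  pose d := e ^+ 2 / 8.
  have d0 : 0 < d by rewrite divr_gt0// exprn_gt0.
  have [a [Ca qa]] := Bn0 _ d0.
  exists a; exists d => // y [Cy qy]; rewrite -ball_normE /=.
  have : `|a - y| ^+ 2 < e ^+ 2.
    apply: le_lt_trans (par _ _ Ca Cy) _.
    by move: qa qy; rewrite /d; have := exprn_gt0 2 e0; lra.
  by rewrite ltr_sqr ?nnegrE ?(ltW e0).
have [c Fc] : exists c : H, F --> c by exists (lim F); exact: cauchy_cvg.
have FC : F C by exists 1; [exact: ltr01|move=> y []].
have Cc : C c by exact: (closed_cvg (u_ := id) C clC FC c Fc).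
have qc : q c <= m.
  have cq : q y @[y --> F] --> q c.
    apply: cvgB; first exact: cvg_inner.
    apply: cvgM; first exact: cvg_cst.
    apply/cvgrPdist_le => e e0.
    have LN x : L (- x) = - L x by rewrite -scaleN1r LZ mulN1r.
    have M1 : 0 < `|M| + 1 by rewrite ltr_wpDl.
    have LM' x : `|L x| <= (`|M| + 1) * `|x|.
      have h w : L w <= (`|M| + 1) * `|w|.
        apply: le_trans (LM w) _; rewrite ler_wpM2r//.
        by rewrite (le_trans (ler_norm _))// lerDl.
      by rewrite ler_norml h andbT lerNl -LN -(normrN x) h.
    near=> y; rewrite -LN -LD (le_trans (LM' _))// mulrC -ler_pdivlMr//.
    by near: y; apply: (cvgrPdist_le _ _).1 => //; rewrite divr_gt0.
  apply/ler_addgt0Pr => e e0; apply: (cvgr_to_le cq).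
  by exists e => // y [].
exists c => // y Cy.
have LN x : L (- x) = - L x by rewrite -scaleN1r LZ mulN1r.
(* First variation of [q] at [c] along the segment to [y], already divided by [t]. *)
have key (t : R) : 0 < t < 1 ->
    0 <= 2 * (inner c (y - c) - L (y - c)) + t * inner (y - c) (y - c).
  move=> t01; have := le_trans qc (mq _ (cvxC _ _ _ Cy Cc t01)).
  have -> : t *: y + (1 - t) *: c = c + t *: (y - c).
    by rewrite scalerBl scale1r scalerBr addrCA.
  rewrite /q; move: (y - c) => w; rewrite LD LZ !innerE (innerC w c) => h.
  have t0 : 0 < t by case/andP : t01.
  rewrite -(pmulr_rge0 _ t0).
  have -> : t * (2 * (inner c w - L w) + t * inner w w) =
     2 * t * (inner c w - L w) + t * (t * inner w w) by ring.
  by lra.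
rewrite leNgt; apply/negP => lt.
pose w := y - c; pose D := L w - inner c w.
have D0 : 0 < D by rewrite subr_gt0.
pose W := inner w w + 1.
have W0 : 0 < W by rewrite ltr_wpDl// inner_ge0.
(* So small that [t * inner w w] is at most [D], whereas [key] would require at least [2 * D]. *)
pose t := Num.min (2^-1) (D / W).
have t0 : 0 < t by rewrite lt_min divr_gt0// invr_gt0 ltr0n.
have t1 : t < 1 by rewrite gt_min; apply/orP; left; lra.
have tD : t * W <= D by rewrite -ler_pdivlMr// ge_min lexx orbT.
have := key t; rewrite t0 t1 => /(_ isT).
have : t * inner w w <= t * W by rewrite ler_wpM2l ?(ltW t0)// lerDl.
rewrite -/w; move: tD D0; rewrite /D; lra.
Unshelve. all: by end_near. Qed.

Lemma riesz (L : H -> R) (M : R) :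
  (forall x y, L (x + y) = L x + L y) -> (forall (a : R) x, L (a *: x) = a * L x) ->
  (forall x, L x <= M * `|x|) -> exists c, forall y, L y = inner c y.
Proof.
move=> LD LZ LM.
have [|//||c _ hc] := @quadratic_min setT L M _ _ _ LD LZ LM.
- exact: closedT.
- by exists 0.
have LN x : L (- x) = - L x by rewrite -scaleN1r LZ mulN1r.
exists c => y; apply/le_anti/andP; split.
  by have := hc (y + c) I; rewrite addrK.
by have := hc (- y + c) I; rewrite addrK LN innerNr lerN2.
Qed.

(** * Weak limits along filters *)

Section weak_limits.
Context {T : Type} (F : set_system T).

Definition weak_limit (x : T -> H) z :=
  forall w, inner (x t) w @[t --> F] --> inner z w.

(** With [c] the projection of [z] on [C], the variational inequality makes
    [inner (x t - c) (z - c)] nonpositive; its limit is the squared norm of [z - c]. *)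
Lemma closed_convex_weak_limit {FF : ProperFilter F} (C : set H) (x : T -> H) z :
  closed C -> convex_subset C -> (\forall t \near F, C (x t)) ->
  weak_limit x z -> C z.
Proof.
move=> clC cvxC Cx xz.
have C0 : C !=set0 by have [t Ct] := filter_ex Cx; exists (x t).
have [c Cc hc] := quadratic_min clC cvxC C0 (innerDr z)
  (fun a => innerZr a z) (inner_le_norm z).
suff -> : z = c by [].
apply/subr0_eq/inner_eq0.
have cv : inner (x t - c) (z - c) @[t --> F] --> inner (z - c) (z - c).
  rewrite innerBl; under eq_fun do rewrite innerBl.
  by apply: cvgB; [exact: xz|exact: cvg_cst].
apply: (cvgr_to_le cv); near=> t.
have /hc : C (x t) by near: t.
by move=> h; rewrite innerC innerBl subr_le0.
Unshelve. all: by end_near. Qed.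

(** By compactness of the segment the image ultrafilter has a cluster point, and an ultrafilter
    converges to each of its cluster points. *)
Lemma ultra_bounded_cvg (f : T -> R) (M : R) : UltraFilter F ->
  (\forall t \near F, `|f t| <= M) -> exists l : R, f t @[t --> F] --> l.
Proof.
move=> UF fM.
have : compact `[- M, M]%classic by exact: segment_compact.
move=> /(_ (f @ F) _)[].
  by near=> t; rewrite /= in_itv/= -ler_norml; near: t.
move=> l [_ cl]; exists l => A Al.
have [//|nA] := in_ultra_setVsetC (f @^-1` A) UF.
by have [y [nAy Ay]] := cl (~` A) A nA Al.
Unshelve. all: by end_near. Qed.

(** The limits of [inner (x t) w] form a bounded linear functional of [w], which Riesz represents by
    a vector. *)
Lemma ultra_weak_limit (x : T -> H) (M : R) : UltraFilter F ->
  (\forall t \near F, `|x t| <= M) -> exists z, weak_limit x z.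
Proof.
move=> UF xM.
have M0 : 0 <= M by have [t] := filter_ex xM; exact: le_trans.
have ex w : exists l : R, inner (x t) w @[t --> F] --> l.
  apply: (@ultra_bounded_cvg _ (M * `|w|)).
  apply: filterS xM => t xt; rewrite (le_trans (norm_inner_le _ _))//.
  by rewrite ler_wpM2r.
pose L w := sval (cid (ex w)).
have cL w : inner (x t) w @[t --> F] --> L w by exact: svalP (cid (ex w)).
have [|||z Lz] := @riesz L M.
- move=> u w; apply: (cvgr_unique (cL (u + w))).
  under eq_fun do rewrite innerDr.
  by apply: cvgD; exact: cL.
- move=> a u; apply: (cvgr_unique (cL (a *: u))).
  under eq_fun do rewrite innerZr.
  by apply: cvgM; [exact: cvg_cst|exact: cL].
- move=> w; apply: (cvgr_to_le (cL w)); apply: filterS xM => t xt.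
  by rewrite (le_trans (inner_le_norm _ _))// ler_wpM2r.
by exists z => w; rewrite -Lz.
Qed.

End weak_limits.

(* By boundedness every ultrafilter refining F has a weak limit; convergence of the
   distances to S forces all these limits to agree. *)
Lemma opial {T : Type} (F : set_system T) {FF : ProperFilter F} (x : T -> H)
    (S : set H) (M : R) :
  (forall t, `|x t| <= M) ->
  (forall z, S z -> exists l : R, `|x t - z| ^+ 2 @[t --> F] --> l) ->
  (forall (U : set_system T) z, UltraFilter U -> F `<=` U -> weak_limit U x z -> S z) ->
  exists2 z, S z & weak_limit F x z.
Proof.
move=> xM dist clust.
have lim U : UltraFilter U -> F `<=` U -> exists2 z, S z & weak_limit U x z.
  move=> UU FU; have [|z xz] := @ultra_weak_limit _ U x M UU; first exact: nearW.
  by exists z => //; exact: clust FU xz.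
have uniq (U V : set_system T) z1 z2 : UltraFilter U -> UltraFilter V ->
    F `<=` U -> F `<=` V -> S z1 -> S z2 -> weak_limit U x z1 -> weak_limit V x z2 ->
    z1 = z2.
  move=> UU UV FU FV S1 S2 x1 x2.
  have [l1 d1] := dist _ S1; have [l2 d2] := dist _ S2.
  (* The difference of the two squared distances is affine in [x t], so the inner product with
     [z2 - z1] converges along [F] itself, and both weak limits inherit its value. *)
  have cw : inner (x t) (z2 - z1) @[t --> F] -->
      2^-1 * (l1 - l2 - (inner z1 z1 - inner z2 z2)).
    have -> : (fun t => inner (x t) (z2 - z1)) = (fun t => 2^-1 *
        (`|x t - z1| ^+ 2 - `|x t - z2| ^+ 2 - (inner z1 z1 - inner z2 z2))).
      apply/funext => t; rewrite !sqr_norm !innerE (innerC z1) (innerC z2); by field.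
    exact: (cvgM (cvg_cst (2^-1 : R)) (cvgB (cvgB d1 d2) (cvg_cst _))).
  have e1 : inner z1 (z2 - z1) = 2^-1 * (l1 - l2 - (inner z1 z1 - inner z2 z2)).
    apply: (cvgr_unique (x1 (z2 - z1))).
    by move=> A /cw; exact: FU.
  have e2 : inner z2 (z2 - z1) = 2^-1 * (l1 - l2 - (inner z1 z1 - inner z2 z2)).
    apply: (cvgr_unique (x2 (z2 - z1))).
    by move=> A /cw; exact: FV.
  apply/esym/subr0_eq/inner_eq0.
  by rewrite innerBl e1 e2 subrr.
have [U0 [UU0 FU0]] := ultraFilterLemma FF.
have [z0 S0 xz0] := lim _ UU0 FU0.
exists z0 => // w; apply/cvgrPdist_le => e e0.
apply: contrapT => nF.
(* If convergence failed in direction [w], an ultrafilter finer than [F] would contain the bad set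
   [A], although its weak limit is again [z0]. *)
pose A := [set t | ~ `|inner z0 w - inner (x t) w| <= e].
have wF : ProperFilter (within A F).
  apply: Build_ProperFilter_ex => P PF; apply: contrapT => nP; apply: nF.
  move: PF; rewrite /within /=; apply: filterS => t h.
  by apply: contrapT => At; apply: nP; exists t; exact: h.
have [U [UU FU]] := ultraFilterLemma wF.
have FU' : F `<=` U by move=> P FP; apply: FU; apply: filterS FP => t Pt _.
have [z Sz xz] := lim _ UU FU'.
have zz := uniq _ _ _ _ UU UU0 FU' FU0 Sz S0 xz xz0; rewrite zz in xz.
have UA : U A by apply: FU; apply: nearW.
have /cvgrPdist_le /(_ _ e0) := xz w => UB.
by have [t [At]] := filter_ex (filterI UA UB).
Qed.

End inner_theory.

(** * Calculus along curves *)

Section curves.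
Context {R : realType}.
Notation mu := (@lebesgue_measure R).

Lemma near_gt0 (t : R) : 0 < t -> \forall s \near t, 0 < s.
Proof.
move=> t0; exists t => //= s /=; rewrite ltr_norml => /andP[_]; lra.
Qed.

Lemma is_derive_near_eq {V : normedModType R} (f g : R -> V) (t : R) (d : V) :
  (\forall s \near t, f s = g s) -> is_derive t 1 f d -> is_derive t 1 g d.
Proof.
move=> fg fd; apply: near_is_derive => e e0.
have ft := nbhs_singleton fg.
by move: fg (is_derive_near fd e0); apply: filterS2 => s <-; rewrite ft.
Qed.

Lemma null_variation_const_continuous {V : normedModType R} (f : R -> V) :
  null_variation f -> (forall t, t <= 0 -> f t = f 0) -> continuous f.
Proof.
move=> nvf f0 t; have [t0|t0] := leP 0 t; first exact: null_variation_continuous.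
apply: cvg_near_cst.
exists (- t); first by rewrite /= oppr_gt0.
move=> s /=; rewrite ltr_norml => /andP[h1 h2].
by rewrite (f0 _ (ltW t0)) (f0 s)//; lra.
Qed.

Lemma continuous_near_bounded {V : normedModType R} (f : R -> V) (b : R) :
  continuous f -> exists2 K, 0 <= K &
    forall t, 0 <= t <= b -> \forall s \near t, `|f s| <= K.
Proof.
move=> cf.
have [b0|b0] := leP 0 b; last first.
  by exists 0 => // t /andP[t0 /(le_trans t0)]; rewrite leNgt b0.
(* The margin 1 on both sides keeps the neighbours of [t] in the segment. *)
have cn : {within `[-1, b + 1], continuous (fun t => `|f t|)}.
  by apply: continuous_subspaceT => t; exact: (cvg_norm (cf t)).
have [|c _ hc] := EVT_max _ cn; first by lra.
exists `|f c| => // t /andP[t0 tb].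
exists 1 => //= s /=; rewrite ltr_norml => /andP[h1 h2].
by apply: hc; rewrite in_itv/=; apply/andP; split; lra.
Qed.

Lemma continuous_le_bounded (g : R -> R) : continuous g ->
  (forall t, t <= 0 -> g t = g 0) ->
  forall b, exists K, forall t, `|t| <= b -> g t <= K.
Proof.
move=> cg g0 b; have [K K0 gK] := continuous_near_bounded b cg.
exists K => t; rewrite ler_norml => /andP[h1 h2].
have [t0|t0] := leP 0 t.
  by apply: le_trans (ler_norm _) _; apply: nbhs_singleton (gK t _); rewrite t0.
rewrite (g0 _ (ltW t0)); apply: le_trans (ler_norm _) _.
by apply: nbhs_singleton (gK 0 _); rewrite lexx; lra.
Qed.

(** Local bounds of the two factors turn the estimate on [B] into the constant of the transfer
    lemma. *)
Lemma null_variation_bilinear {V1 V2 W : normedModType R} (B : V1 -> V2 -> W)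
    (f : R -> V1) (g : R -> V2) :
  (forall u v u' v', `|B u v - B u' v'| <= `|u| * `|v - v'| + `|v'| * `|u - u'|) ->
  continuous f -> continuous g -> null_variation f -> null_variation g ->
  null_variation (fun t => B (f t) (g t)).
Proof.
move=> hB cf cg nvf nvg; apply: (null_variation_le2 nvf nvg) => b.
have [K1 K10 fK] := continuous_near_bounded b cf.
have [K2 K20 gK] := continuous_near_bounded b cg.
exists (K1 + K2); first exact: addr_ge0.
move=> t tb; have gt := nbhs_singleton (gK t tb).
move: (fK t tb); apply: filterS => s fs.
apply: le_trans (hB _ _ _ _) _; rewrite mulrDr addrC; apply: lerD.
  by rewrite ler_wpM2r// (le_trans gt)// lerDr.
by rewrite ler_wpM2r// (le_trans fs)// lerDl.
Qed.

Lemma null_variationM (f g : R -> R) :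
  continuous f -> continuous g ->
  null_variation (f : R -> R^o) -> null_variation (g : R -> R^o) ->
  null_variation ((fun t => f t * g t) : R -> R^o).
Proof.
move=> cf cg; apply: (@null_variation_bilinear R^o R^o R^o (fun a b => a * b)) => //.
move=> u v u' v'; have -> : u * v - u' * v' = u * (v - v') + v' * (u - u') by ring.
by rewrite (le_trans (ler_normD _ _))// !normrM.
Qed.

Lemma null_variationD {V : normedModType R} (f g : R -> V) :
  null_variation f -> null_variation g -> null_variation (fun t => f t + g t).
Proof.
move=> nvf nvg; apply: (null_variation_le2 nvf nvg).
move=> b; exists 1 => // t _; apply: (@nearW _ (nbhs t)) => s; rewrite mul1r.
by rewrite opprD addrACA; exact: ler_normD.
Qed.

Lemma null_variationN {V : normedModType R} (f : R -> V) :
  null_variation f -> null_variation (fun t => - f t).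
Proof.
move=> nvf; apply: (null_variation_le2 nvf nvf).
move=> b; exists 1 => // t _; apply: (@nearW _ (nbhs t)) => s; rewrite mul1r.
by rewrite -opprD normrN lerDl.
Qed.

Lemma null_variation_cst {V : normedModType R} (a : V) :
  null_variation (fun _ : R => a).
Proof.
apply: null_variation_lipschitz => b; exists 0 => // t _.
by apply: (@nearW _ (nbhs t)) => s; rewrite subrr normr0 mul0r.
Qed.

Lemma null_variationB {V : normedModType R} (f g : R -> V) :
  null_variation f -> null_variation g -> null_variation (fun t => f t - g t).
Proof. by move=> nvf nvg; apply: null_variationD => //; exact: null_variationN. Qed.

Lemma null_variationZ (a : R) (f : R -> R) :
  null_variation (f : R -> R^o) -> null_variation ((fun t => a * f t) : R -> R^o).
Proof.
move=> nvf; apply: (null_variation_le2 nvf nvf).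
move=> b; exists `|a| => // t _; apply: (@nearW _ (nbhs t)) => s.
by rewrite -mulrBr normrM ler_wpM2l// lerDl.
Qed.

End curves.

Section hilbert_curves.
Context {R : realType} {H : hilbertType R}.

Lemma null_variation_inner (f g : R -> H) :
  continuous f -> continuous g -> null_variation f -> null_variation g ->
  null_variation ((fun t => inner (f t) (g t)) : R -> R^o).
Proof.
move=> cf cg; apply: (@null_variation_bilinear _ H H R^o (@inner R H)) => //.
exact: norm_innerB_le.
Qed.

Lemma is_derive_inner (f g : R -> H) (t : R) (df dg : H) :
  is_derive t 1 f df -> is_derive t 1 g dg ->
  is_derive t 1 ((fun s => inner (f s) (g s)) : R -> R^o)
    (inner (f t) dg + inner df (g t)).
Proof.
move=> fd gd.
have cg : g @ t --> g t.
  by apply: differentiable_continuous; apply/derivable1_diffP.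
have f1 : h^-1 *: (f (h *: 1 + t) - f t) @[h --> 0^'] --> df.
  by have [df' <-] := fd.
have g1 : h^-1 *: (g (h *: 1 + t) - g t) @[h --> 0^'] --> dg.
  by have [dg' <-] := gd.
have g2 : g (h *: 1 + t) @[h --> 0^'] --> g t.
  have ht : (h *: 1 + t : R) @[h --> (0 : R)^'] --> t.
    apply/cvgrPdist_le => e e0; exists e => // h /=; rewrite sub0r normrN => he _.
    by rewrite opprD addrCA subrr addr0 normrN [h *: 1]mulr1 ltW.
  exact: (cvg_comp _ _ ht cg).
have h : h^-1 *: ((inner (f (h *: 1 + t)) (g (h *: 1 + t)) - inner (f t) (g t)) : R^o)
    @[h --> 0^'] --> inner (f t) dg + inner df (g t).
  have -> : (fun h : R => h^-1 *: ((inner (f (h *: 1 + t)) (g (h *: 1 + t))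
      - inner (f t) (g t)) : R^o)) =
    (fun h => inner (f t) (h^-1 *: (g (h *: 1 + t) - g t)) +
      inner (h^-1 *: (f (h *: 1 + t) - f t)) (g (h *: 1 + t))).
    apply/funext => h; rewrite !innerE /GRing.scale/=; ring.
  by apply: cvgD; apply: cvg_inner => //; exact: cvg_cst.
have dh : derivable ((fun s => inner (f s) (g s)) : R -> R^o) t 1.
  by apply/cvg_ex; eexists; exact: h.
by apply: DeriveDef => //; exact: cvg_lim h.
Qed.

(* f is the value along X of a convex function whose subdifferential at X s contains p s. *)
Lemma is_derive_subgradient (f : R -> R) (X p : R -> H) (t : R) (d : H) :
  (\forall s \near t, f t + inner (p t) (X s - X t) <= f s /\
     f s + inner (p s) (X t - X s) <= f t) ->
  {for t, continuous p} -> is_derive t 1 X d ->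
  is_derive t 1 (f : R -> R^o) (inner (p t) d).
Proof.
move=> fp cp Xd; apply: near_is_derive => e e0.
(* Half of [e] is spent on the variation of [p], half on the first-order error of [X]. *)
pose e1 := e / 2 / (`|d| + 1).
have d1 : 0 < `|d| + 1 by rewrite ltr_wpDl.
have e10 : 0 < e1 by rewrite !divr_gt0.
pose e2 := e / 2 / (`|p t| + 1).
have p1 : 0 < `|p t| + 1 by rewrite ltr_wpDl.
have e20 : 0 < e2 by rewrite !divr_gt0.
have pe1 : \forall s \near t, `|p t - p s| <= e1.
  by have /cvgrPdist_le := cp; apply.
near=> s.
have [h1 h2] : f t + inner (p t) (X s - X t) <= f s /\
     f s + inner (p s) (X t - X s) <= f t by near: s.
have h3 : `|p t - p s| <= e1 by near: s; exact: pe1.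
have h4 : `|X s - X t - (s - t) *: d| <= e2 * `|s - t|.
  by near: s; exact: is_derive_near.
have h5 : `|X s - X t - (s - t) *: d| <= 1 * `|s - t|.
  by near: s; exact: is_derive_near.
have Xst : `|X s - X t| <= (`|d| + 1) * `|s - t|.
  rewrite -[X in `|X|](subrK ((s - t) *: d)) (le_trans (ler_normD _ _))//.
  by rewrite normrZ mulrDl addrC lerD// mulrC.
rewrite /GRing.scale /=.
have -> : f s - f t - (s - t) * inner (p t) d =
   (f s - f t - inner (p t) (X s - X t)) + inner (p t) (X s - X t - (s - t) *: d).
  by rewrite !innerE; ring.
rewrite (le_trans (ler_normD _ _))// (splitr e) mulrDl; apply: lerD.
  (* By the two inequalities this term lies between 0 and [inner (p s - p t) (X s - X t)], which is
     small against [s - t] by continuity of [p]. *)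
  rewrite ger0_norm; last by rewrite subr_ge0 lerBrDl.
  have -> : e / 2 = e1 * (`|d| + 1) by rewrite /e1 divfK// gt_eqF.
  apply: (@le_trans _ _ (inner (p s - p t) (X s - X t))).
    by move: h2; rewrite !innerE; lra.
  rewrite (le_trans (inner_le_norm _ _))// -mulrA distrC ler_pM//.
rewrite (le_trans (norm_inner_le _ _))//.
have -> : e / 2 = (`|p t| + 1) * e2 by rewrite /e2 [RHS]mulrC divfK// gt_eqF.
by rewrite -mulrA ler_pM// lerDl.
Unshelve. all: by end_near. Qed.

(** Used in both directions, the inequality bounds an increment of [f] by that of [X] times a local
    bound of [p]. *)
Lemma null_variation_subgradient (f : R -> R) (X p : R -> H) :
  (forall t s, f t + inner (p t) (X s - X t) <= f s) ->
  continuous p -> null_variation X -> null_variation (f : R -> R^o).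
Proof.
move=> fp cp nvX; apply: (null_variation_le2 nvX nvX) => b.
have [K K0 pK] := continuous_near_bounded b cp; exists K => // t tb.
have pt := nbhs_singleton (pK t tb).
move: (pK t tb); apply: filterS => s ps.
have h1 := fp t s; have h2 := fp s t.
apply: (@le_trans _ _ (K * `|X s - X t|)); last by rewrite ler_wpM2l// lerDl.
have h3 : `|inner (p t) (X s - X t)| <= K * `|X s - X t|.
  by rewrite (le_trans (norm_inner_le _ _))// ler_wpM2r.
have h4 : `|inner (p s) (X t - X s)| <= K * `|X s - X t|.
  by rewrite (le_trans (norm_inner_le _ _))// distrC ler_wpM2r.
by move: h3 h4; rewrite !ler_norml => /andP[? ?] /andP[? ?]; apply/andP; split; lra.
Qed.

End hilbert_curves.

(** * Gradients of convex functions *)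

Section gradient.
Context {R : realType} {H : hilbertType R}.

(** The differential is continuous, hence bounded, so Riesz provides a representative and the
    default value in [gradient] is not taken. *)
Lemma gradientP (g : H -> R) (x h : H) : differentiable (g : H -> R^o) x ->
  'd (g : H -> R^o) x h = inner (gradient g x) h.
Proof.
move=> dg; rewrite /gradient.
pose P := [set u : H | forall h, 'd (g : H -> R^o) x h = inner u h].
suff : exists u, P u by move=> /(xgetPex 0); exact.
have /linear_boundedP : bounded_near ('d (g : H -> R^o) x) (nbhs (0 : H)).
  by apply: continuous_linear_bounded; apply: diff_continuous.
move=> [M [_ hM]].
have [||y|c hc] := @riesz _ _ (fun y => 'd (g : H -> R^o) x y) (M + 1).
- by move=> u v; rewrite linearD.
- by move=> a u; rewrite linearZ.
- by rewrite (le_trans (ler_norm _))// hM// ltrDl.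
by exists c.
Qed.

(** By convexity the difference quotients in direction [y - x] stay below [g y - g x] for steps at
    most 1; the derivative is their limit from the right. *)
Lemma gradient_subgradient (g : H -> R) : convex_function setT g ->
  Frechet_differentiable g ->
  forall x y, g x + inner (gradient g x) (y - x) <= g y.
Proof.
move=> cvx dg x y; rewrite -gradientP// -deriveE// addrC -lerBrDr.
have /cvg_dnbhs_at_right h : h^-1 *: (g (h *: (y - x) + x) - g x) @[h --> (0 : R)^'] -->
    ('D_(y - x) (g : H -> R^o) x : R^o).
  by have := @diff_derivable _ _ _ (g : H -> R^o) x (y - x) (dg x).
apply: (cvgr_to_le h); near=> t.
have t0 : 0 < t by [].
have t1 : t <= 1 by apply: ltW; near: t; exact: nbhs_right_lt.
have yxE : t *: (y - x) + x = t *: y + (1 - t) *: x.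
  by rewrite scalerBr scalerBl scale1r -addrA [- _ + x]addrC.
have : g (t *: (y - x) + x) <= t * g y + (1 - t) * g x.
  rewrite yxE.
  by have := cvx (Itv01 (ltW t0) t1) y x (in_setT _) (in_setT _).
by rewrite /GRing.scale /= ler_pdivrMl//; lra.
Unshelve. all: by end_near. Qed.

Lemma gradient_lipschitz_continuous (g : H -> R) :
  lipschitz (gradient g) -> continuous (gradient g).
Proof.
move=> [M [_ /(_ (`|M| + 1))]].
have M1 : M < `|M| + 1 by rewrite (le_lt_trans (ler_norm _))// ltrDl.
move=> /(_ M1) lip x; apply/cvgrPdist_le => e e0.
have M0 : 0 < `|M| + 1 by rewrite ltr_wpDl.
apply/nbhs_ballP; exists (e / (`|M| + 1)); first by rewrite /= divr_gt0.
move=> y; rewrite -ball_normE /= => xy.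
apply: le_trans (lip (x, y) _) _ => //=.
by rewrite mulrC -ler_pdivlMr// ltW.
Qed.

End gradient.

Section scalar_derivatives.
Context {R : realType}.
Implicit Types (f g : R -> R) (t : R).

Lemma is_derive_add f g t (a b : R) : is_derive t 1 (f : R -> R^o) a ->
  is_derive t 1 (g : R -> R^o) b ->
  is_derive t 1 ((fun s => f s + g s) : R -> R^o) (a + b).
Proof. exact: is_deriveD. Qed.

Lemma is_derive_opp f t (a : R) : is_derive t 1 (f : R -> R^o) a ->
  is_derive t 1 ((fun s => - f s) : R -> R^o) (- a).
Proof. exact: is_deriveN. Qed.

Lemma is_derive_sub f g t (a b : R) : is_derive t 1 (f : R -> R^o) a ->
  is_derive t 1 (g : R -> R^o) b ->
  is_derive t 1 ((fun s => f s - g s) : R -> R^o) (a - b).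
Proof. exact: is_deriveB. Qed.

Lemma is_derive_scale (c : R) f t (a : R) : is_derive t 1 (f : R -> R^o) a ->
  is_derive t 1 ((fun s => c * f s) : R -> R^o) (c * a).
Proof. exact: is_deriveZ. Qed.

Lemma is_derive_mul f g t (a b : R) : is_derive t 1 (f : R -> R^o) a ->
  is_derive t 1 (g : R -> R^o) b ->
  is_derive t 1 ((fun s => f s * g s) : R -> R^o) (f t * b + g t * a).
Proof. exact: is_deriveM. Qed.

Lemma is_derive_clip t : 0 < t ->
  is_derive t 1 ((fun s => Num.max s 0) : R -> R^o) 1.
Proof.
move=> t0; apply: (@is_derive_near_eq _ R^o id).
by apply: filterS (near_gt0 t0) => s s0; rewrite /= max_l// ltW.
Qed.

End scalar_derivatives.

Section monotone_derivative.
Context {R : realType} {H : hilbertType R}.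

(** The inner product of the two difference quotients is the monotonicity expression divided by
    [h ^+ 2]. *)
Lemma inner_derive_ge0 (f g : R -> H) (t : R) (df dg : H) :
  (forall s, 0 <= inner (f s - f t) (g s - g t)) ->
  is_derive t 1 f df -> is_derive t 1 g dg -> 0 <= inner df dg.
Proof.
move=> fg fd gd.
have f1 : h^-1 *: (f (h *: 1 + t) - f t) @[h --> (0 : R)^'] --> df.
  by have [df' <-] := fd.
have g1 : h^-1 *: (g (h *: 1 + t) - g t) @[h --> (0 : R)^'] --> dg.
  by have [dg' <-] := gd.
apply: (cvgr_to_ge (cvg_inner f1 g1)); apply: nearW => h.
by rewrite innerZl innerZr mulrA -expr2 mulr_ge0// sqr_ge0.
Qed.

End monotone_derivative.

(** * Lyapunov analysis of the trajectory *)

Section continuous_primitives.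
Context {R : realType}.
Notation mu := (@lebesgue_measure R).

(** Constancy before 0 makes [g] bounded on symmetric intervals, as the lemmas on [prim] require. *)
Definition primitivable (g : R -> R) :=
  [/\ continuous g, forall t, 0 <= g t & forall t, t <= 0 -> g t = g 0].

Variable g : R -> R.
Hypothesis pg : primitivable g.

Let mg : measurable_fun setT g.
Proof. by case: pg => cg _ _; exact: continuous_measurable_fun. Qed.

Let g0 t : 0 <= g t. Proof. by case: pg. Qed.

Let bg b : exists K, forall t, `|t| <= b -> g t <= K.
Proof. by case: pg => cg _ gN; exact: continuous_le_bounded. Qed.

Lemma primitivable_null_variation : null_variation (prim g : R -> R^o).
Proof. exact: null_variation_prim. Qed.

Lemma primitivable_is_derive : {ae mu, forall t : R, 0 <= t ->
  is_derive t 1 (prim g : R -> R^o) (g t)}.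
Proof. exact: prim_is_derive. Qed.

Lemma primitivable_nondecreasing s t : 0 <= s -> s <= t -> prim g s <= prim g t.
Proof. exact: prim_nondecreasing. Qed.

Lemma primitivable_ge0 t : 0 <= prim g t.
Proof. exact: prim_ge0. Qed.

Lemma primitivableE t : 0 <= t ->
  ((prim g t)%:E = \int[mu]_(r in `[0%R, t]) (g r)%:E)%E.
Proof. exact: primE. Qed.

Lemma prim_bounded_lower_integral (C : R) :
  (forall t, 0 <= t -> prim g t <= C) ->
  (\int[mu]_(t in `[0%R, +oo[) (g t)%:E <= C%:E)%E.
Proof.
move=> gC; apply: (lower_integral_le_increment primitivable_null_variation) => //.
  apply: (@filterS _ _ (ae_filter_ringOfSetsType mu)) primitivable_is_derive.
  by move=> t h t0; exists (g t) => //; exact: h.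
by move=> t t0; rewrite (prim_le0 _ (lexx 0)) subr0 gC.
Qed.

End continuous_primitives.

(** * Estimates for an abstract trajectory *)

Section trajectory.
Context {R : realType} {H : hilbertType R}.
Notation mu := (@lebesgue_measure R).
(** [phi], [theta], [psi] stand for the values of the three functions along [X], and [gT], [gP] for
    the gradients. Convexity survives only as subgradient inequalities between two times. *)
Variables (X V gT gP dX dV : R -> H) (L B dL dB phi theta psi : R -> R).
Variables (k l : R).
Hypotheses (nvX : null_variation X) (nvV : null_variation V).
Hypotheses (nvL : null_variation (L : R -> R^o)) (nvB : null_variation (B : R -> R^o)).
Hypotheses (XN : forall t, t <= 0 -> X t = X 0) (VN : forall t, t <= 0 -> V t = V 0).
Hypotheses (LN : forall t, t <= 0 -> L t = L 0) (BN : forall t, t <= 0 -> B t = B 0).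
Hypothesis phi_sub : forall t s, phi t + inner (V t) (X s - X t) <= phi s.
Hypothesis theta_sub : forall t s, theta t + inner (gT t) (X s - X t) <= theta s.
Hypothesis psi_sub : forall t s, psi t + inner (gP t) (X s - X t) <= psi s.
Hypotheses (cgT : continuous gT) (cgP : continuous gP).
Hypothesis psi_ge0 : forall t, 0 <= psi t.
Hypotheses (l_gt0 : 0 < l) (lL : forall t, l <= L t) (cL : L t @[t --> +oo] --> l).
Hypotheses (B_gt0 : forall t, 0 < B t) (k_ge0 : 0 <= k).
Hypothesis ode : {ae mu, forall t : R, 0 <= t ->
  [/\ is_derive t 1 X (dX t), is_derive t 1 V (dV t),
      is_derive t 1 (L : R -> R^o) (dL t), is_derive t 1 (B : R -> R^o) (dB t) &
      [/\ dL t <= 0, 0 <= dB t <= k * B t &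
          L t *: dX t + dV t + V t + gT t + B t *: gP t = 0]]}.

Let cX : continuous X. Proof. exact: null_variation_const_continuous. Qed.
Let cV : continuous V. Proof. exact: null_variation_const_continuous. Qed.
Let cLc : continuous (L : R -> R^o).
Proof. exact: null_variation_const_continuous. Qed.
Let cB : continuous (B : R -> R^o).
Proof. exact: null_variation_const_continuous. Qed.

Let nvphi : null_variation (phi : R -> R^o).
Proof. exact: null_variation_subgradient phi_sub cV nvX. Qed.
Let nvtheta : null_variation (theta : R -> R^o).
Proof. exact: null_variation_subgradient theta_sub cgT nvX. Qed.
Let nvpsi : null_variation (psi : R -> R^o).
Proof. exact: null_variation_subgradient psi_sub cgP nvX. Qed.

Let subN (f : R -> R) (p : R -> H) :
  (forall t s, f t + inner (p t) (X s - X t) <= f s) -> forall t, t <= 0 -> f t = f 0.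
Proof.
move=> fp t t0; have Xt := XN t0; apply/le_anti/andP; split.
  by have := fp t 0; rewrite Xt subrr inner0r addr0.
by have := fp 0 t; rewrite Xt subrr inner0r addr0.
Qed.

Let phiN := subN phi_sub.
Let thetaN := subN theta_sub.
Let psiN := subN psi_sub.

Let cphi : continuous (phi : R -> R^o).
Proof. exact: null_variation_const_continuous. Qed.
Let cpsi : continuous (psi : R -> R^o).
Proof. exact: null_variation_const_continuous. Qed.

Let subD (f : R -> R) (p : R -> H) :
  (forall t s, f t + inner (p t) (X s - X t) <= f s) -> continuous p ->
  forall (t : R) (d : H), is_derive t 1 X d -> is_derive t 1 (f : R -> R^o) (inner (p t) d).
Proof.
move=> fp cp t d; apply: is_derive_subgradient => //; first last.
  exact: cp.
by apply: (@nearW _ (nbhs t)) => s; split; exact: fp.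
Qed.

Lemma velocities_monotone : {ae mu, forall t : R, 0 <= t -> 0 <= inner (dX t) (dV t)}.
Proof.
apply: (@filterS _ _ (ae_filter_ringOfSetsType mu)) ode => t h t0.
have [dXt dVt _ _ _] := h t0.
apply: inner_derive_ge0 dXt dVt => s.
have := phi_sub s t; have := phi_sub t s; rewrite !innerE !(innerC (X _)); lra.
Qed.

Definition energy t := phi t + theta t + B t * psi t.

Lemma energy_null_variation : null_variation (energy : R -> R^o).
Proof.
apply: null_variationD; first exact: null_variationD.
exact: null_variationM.
Qed.

Lemma energy_derive : {ae mu, forall t : R, 0 <= t ->
  exists2 d, is_derive t 1 (energy : R -> R^o) d &
    d <= k * (B t * psi t) - (L t * `|dX t| ^+ 2 + inner (dX t) (dV t))}.
Proof.
apply: (@filterS _ _ (ae_filter_ringOfSetsType mu)) ode => t h t0.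
have [dXt dVt dLt dBt [Lt0 /andP[Bt0 Btk] eq0]] := h t0.
have e1 := is_derive_add (is_derive_add (subD phi_sub cV dXt) (subD theta_sub cgT dXt))
  (is_derive_mul dBt (subD psi_sub cgP dXt)).
exists (inner (V t) (dX t) + inner (gT t) (dX t)
  + (B t * inner (gP t) (dX t) + psi t * dB t)) => //.
(* Pairing the equation with [dX t] replaces the subgradient terms by minus the velocity terms; the
   growth bound on [dB t] accounts for the rest. *)
have := congr1 (fun u => inner u (dX t)) eq0.
rewrite !innerE sqr_norm (innerC (dX t) (dV t)) => eq1.
have : psi t * dB t <= psi t * (k * B t) by rewrite ler_wpM2l.
by rewrite (mulrCA (psi t)) (mulrC (psi t)); lra.
Qed.

Let pBpsi : primitivable (fun t => B t * psi t).
Proof.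
split; first by move=> t; apply: cvgM; [exact: cB|exact: cpsi].
  by move=> t; rewrite mulr_ge0// ltW.
by move=> t t0; rewrite (BN t0) (psiN t0).
Qed.

Section lyapunov.
(** [z] stands for a solution, [p] for its multiplier, [Phiz] and [Thetaz] for the values at [z],
    and [K] for the integral of the conjugate gap at twice [p]. The multiplier relation enters
    through [value_z], feasibility of [z] through the 0 in [psi_z]. *)
Variables (z p : H) (Phiz Thetaz K : R).
Hypothesis phi_z : forall t, phi t + inner (V t) (z - X t) <= Phiz.
Hypothesis theta_z : forall t, theta t + inner (gT t) (z - X t) <= Thetaz.
Hypothesis psi_z : forall t, psi t + inner (gP t) (z - X t) <= 0.
Hypothesis value_z : forall t,
  Phiz + Thetaz - inner p (X t - z) <= phi t + theta t.

Let V0 := Phiz + Thetaz.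
(* The factor 2 is what leaves half of the penalty B psi on the good side in
   [gap_le]. *)
Definition penalty_gap t := 2 * inner p (X t - z) - B t * psi t.
Let w := penalty_gap.
Definition penalty_gap_pos t := Num.max (penalty_gap t) 0.
Let wp := penalty_gap_pos.

Hypothesis gap_decay : forall t, 0 <= t -> t * w t <= K.
Hypothesis gap_integrable : forall t, 0 <= t ->
  (\int[mu]_(r in `[0%R, t]) (wp r)%:E <= K%:E)%E.

Definition bregman t := Phiz - phi t + inner (V t) (X t - z).
Let D := bregman.
Definition lyapunov t := 2^-1 * (L t * inner (X t - z) (X t - z)) + D t.
Let h := lyapunov.

Let nvXz : null_variation (fun t => X t - z).
Proof. by apply: null_variationB => //; exact: null_variation_cst. Qed.

Let cXz : continuous (fun t => X t - z).
Proof. by move=> t; apply: cvgB; [exact: cX|exact: cvg_cst]. Qed.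

Let cS : continuous (fun t => inner (X t - z) (X t - z) : R^o).
Proof. by move=> t; apply: cvg_inner; exact: cXz. Qed.

Let nvS : null_variation ((fun t => inner (X t - z) (X t - z)) : R -> R^o).
Proof. exact: null_variation_inner. Qed.

Let cw : continuous (w : R -> R^o).
Proof.
move=> t; apply: cvgB.
  by apply: cvgM; [exact: cvg_cst|apply: cvg_inner; [exact: cvg_cst|exact: cXz]].
by apply: cvgM; [exact: cB|exact: cpsi].
Qed.

Let pD : primitivable D.
Proof.
split.
- move=> t; apply: cvgD; first by apply: cvgB; [exact: cvg_cst|exact: cphi].
  by apply: cvg_inner; [exact: cV|exact: cXz].
- by move=> t; rewrite /D /bregman; have := phi_z t; rewrite !innerE; lra.
- by move=> t t0; rewrite /D /bregman (phiN t0) (VN t0) (XN t0).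
Qed.

Let pwp : primitivable wp.
Proof.
split.
- move=> t; apply: (@continuous_max _ _ w (fun=> 0)); first exact: cw.
  exact: cvg_cst.
- by move=> t; rewrite le_max lexx orbT.
- by move=> t t0; rewrite /wp /penalty_gap_pos /penalty_gap (BN t0) (psiN t0) (XN t0).
Qed.

Let prim_gap_le t : 0 <= t -> prim wp t <= K.
Proof. by move=> t0; rewrite -lee_fin primitivableE// gap_integrable. Qed.

Lemma lyapunov_ge t : 2^-1 * l * inner (X t - z) (X t - z) <= h t.
Proof.
have [_ D0 _] := pD; rewrite /h /lyapunov -mulrA.
have : l * inner (X t - z) (X t - z) <= L t * inner (X t - z) (X t - z).
  by rewrite ler_wpM2r// inner_ge0.
by have := D0 t; lra.
Qed.

Lemma lyapunov_ge0 t : 0 <= h t.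
Proof.
apply: le_trans (lyapunov_ge t); rewrite mulr_ge0 ?inner_ge0// mulr_ge0// ltW//.
Qed.

Lemma lyapunov_null_variation : null_variation (h : R -> R^o).
Proof.
apply: null_variationD; first by apply: null_variationZ; exact: null_variationM.
apply: null_variationD; last exact: null_variation_inner.
by apply: null_variationB => //; exact: null_variation_cst.
Qed.

(** The equation is paired with [X t - z]: the two terms [inner (V t) (dX t)] cancel, the term in
    [dL t] has the good sign, and [theta_z] and [psi_z] replace gradients by values. *)
Lemma lyapunov_derive : {ae mu, forall t : R, 0 <= t ->
  exists2 d, is_derive t 1 (h : R -> R^o) d & d <= - (D t + (energy t - V0))}.
Proof.
apply: (@filterS _ _ (ae_filter_ringOfSetsType mu)) ode => t ht t0.
have [dXt dVt dLt dBt [Lt0 /andP[Bt0 Btk] eq0]] := ht t0.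
have dXz : is_derive t 1 (fun s => X s - z) (dX t).
  by rewrite -[dX t]subr0; apply: is_deriveB.
have e1 := is_derive_scale (2^-1) (is_derive_mul dLt (is_derive_inner dXz dXz)).
have e2 := is_derive_sub (is_derive_cst (Phiz : R^o) t 1) (subD phi_sub cV dXt).
have e3 := is_derive_add e1 (is_derive_add e2 (is_derive_inner dVt dXz)).
exists (2^-1 * (L t * (inner (X t - z) (dX t) + inner (dX t) (X t - z))
   + inner (X t - z) (X t - z) * dL t)
  + (0 - inner (V t) (dX t) + (inner (V t) (dX t) + inner (dV t) (X t - z)))).
  exact: e3.
have eq1 := congr1 (fun u => inner u (X t - z)) eq0.
rewrite /= !innerDl !innerZl inner0l in eq1.
rewrite (innerC (X t - z) (dX t)).
have hS : inner (X t - z) (X t - z) * dL t <= 0.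
  by rewrite mulr_ge0_le0// inner_ge0.
have hB : 0 <= B t * (- psi t - inner (gP t) (z - X t)).
  by rewrite mulr_ge0 ?(ltW (B_gt0 t))//; have := psi_z t; lra.
have := theta_z t; move: hB eq1 hS.
rewrite /D /bregman /energy /V0 -(opprB (X t) z) !innerNr.
move: (inner (X t - z) (X t - z)) (inner (gP t) (X t - z)) => s1 s2.
by lra.
Qed.

Let gap_le t : 2^-1 * (B t * psi t) - 2^-1 * w t <= energy t - V0.
Proof.
by rewrite /w /penalty_gap /energy /V0; have := value_z t; lra.
Qed.

(** Integrated Lyapunov inequality. Taking the positive part of the gap makes every primitive
    monotone; since that of [wp] is bounded by [K], each of the other terms is bounded
    separately. *)
Let Fh t := 2^-1 * prim wp t - h t - prim D t - 2^-1 * prim (fun t => B t * psi t) t.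

Let nvFh : null_variation (Fh : R -> R^o).
Proof.
apply: null_variationB; last first.
  by apply: null_variationZ; exact: primitivable_null_variation.
apply: null_variationB; last exact: primitivable_null_variation.
apply: null_variationB; last exact: lyapunov_null_variation.
by apply: null_variationZ; exact: primitivable_null_variation.
Qed.

Let Fh_nd s t : 0 <= s -> s <= t -> Fh s <= Fh t.
Proof.
apply: null_variation_nondecreasing => //.
have hwp := primitivable_is_derive pwp; have hD := primitivable_is_derive pD.
have hB := primitivable_is_derive pBpsi.
have FF := ae_filter_ringOfSetsType mu.
apply: (@filterS3 _ _ FF) lyapunov_derive (filterI hwp hD) hB.
move=> r h1 [h2 h3] h4 r0; have [d hd dle] := h1 r0.
have e := is_derive_sub (is_derive_sub (is_derive_sub (is_derive_scale (2^-1) (h2 r0)) hd)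
  (h3 r0)) (is_derive_scale (2^-1) (h4 r0)).
exists (2^-1 * wp r - d - D r - 2^-1 * (B r * psi r)) => //.
have := gap_le r; have : w r <= wp r by rewrite /wp /penalty_gap_pos le_max lexx.
by move: dle; lra.
Qed.

Let C0 := h 0 + 2^-1 * K.

Lemma lyapunov_bound t : 0 <= t ->
  h t + prim D t + 2^-1 * prim (fun t => B t * psi t) t <= C0.
Proof.
move=> t0; have := Fh_nd (lexx 0) t0; rewrite /Fh /C0.
rewrite (prim_le0 wp (lexx 0)) (prim_le0 D (lexx 0)).
rewrite (prim_le0 (fun t => B t * psi t) (lexx 0)).
by have := prim_gap_le t0; lra.
Qed.

Let prim_penalty_le t : 0 <= t -> prim (fun t => B t * psi t) t <= 2 * C0.
Proof.
move=> t0; have := lyapunov_bound t0; have := lyapunov_ge0 t.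
by have := primitivable_ge0 pD t; lra.
Qed.

Let prim_bregman_le t : 0 <= t -> prim D t <= C0.
Proof.
move=> t0; have := lyapunov_bound t0; have := lyapunov_ge0 t.
by have := primitivable_ge0 pBpsi t; lra.
Qed.

Let lyapunov_le t : 0 <= t -> h t <= C0.
Proof.
move=> t0; have := lyapunov_bound t0; have := primitivable_ge0 pD t.
by have := primitivable_ge0 pBpsi t; lra.
Qed.

Lemma trajectory_bounded : exists M, forall t, `|X t - z| <= M.
Proof.
exists (Num.sqrt (2 * C0 / l)).
have h0 t : 0 <= t -> `|X t - z| <= Num.sqrt (2 * C0 / l).
  move=> t0; rewrite norm_inner ler_wsqrtr// ler_pdivlMr//.
  by have := lyapunov_le t0; have := lyapunov_ge t; lra.
by move=> t; have [/h0 //|/ltW/XN ->] := leP 0 t; exact: h0.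
Qed.

(** Its derivative is at least [l * |dX t| ^+ 2 + inner (dX t) (dV t)], so its bounded increments
    control the velocities, the convergence of the energy and the variation of the distance to
    [z]. *)
Let F t := k * prim (fun t => B t * psi t) t - energy t.

Let nvF : null_variation (F : R -> R^o).
Proof.
apply: null_variationB; last exact: energy_null_variation.
by apply: null_variationZ; exact: primitivable_null_variation.
Qed.

Let F_derive : {ae mu, forall t : R, 0 <= t ->
  exists2 d, is_derive t 1 (F : R -> R^o) d &
    0 <= inner (dX t) (dV t) /\ l * `|dX t| ^+ 2 + inner (dX t) (dV t) <= d}.
Proof.
have FF := ae_filter_ringOfSetsType mu.
apply: (@filterS3 _ _ FF) energy_derive (primitivable_is_derive pBpsi)
  velocities_monotone => t h1 h2 h3 t0.
have [d Ed dle] := h1 t0.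
exists (k * (B t * psi t) - d).
  exact: is_derive_sub (is_derive_scale k (h2 t0)) Ed.
split; first exact: h3.
have : l * `|dX t| ^+ 2 <= L t * `|dX t| ^+ 2 by rewrite ler_wpM2r// sqr_ge0.
by lra.
Qed.

Let F_nd s t : 0 <= s -> s <= t -> F s <= F t.
Proof.
apply: null_variation_nondecreasing => //.
apply: (@filterS _ _ (ae_filter_ringOfSetsType mu)) F_derive => r hr r0.
have [d Fd [h1 h2]] := hr r0; exists d => //; apply: le_trans h2.
by rewrite addr_ge0// mulr_ge0 ?sqr_ge0// ltW.
Qed.

(** The penalty has a bounded primitive, and [value_z] on a bounded trajectory keeps the energy
    bounded below. *)
Let F_le : exists C, forall t, 0 <= t -> F t <= C.
Proof.
have [M XM] := trajectory_bounded.
exists (k * (2 * C0) - V0 + `|p| * M) => t t0.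
have := value_z t; have := inner_le_norm p (X t - z).
have : `|p| * `|X t - z| <= `|p| * M by rewrite ler_wpM2l.
have : k * prim (fun t => B t * psi t) t <= k * (2 * C0).
  by rewrite ler_wpM2l// prim_penalty_le.
have [_ Bp0 _] := pBpsi; have := Bp0 t.
by rewrite /F /energy /V0; lra.
Qed.

Lemma penalty_integral : exists C : R,
  (\int[mu]_(t in `[0%R, +oo[) (B t * psi t)%:E <= C%:E)%E.
Proof. by exists (2 * C0); exact: prim_bounded_lower_integral. Qed.

Let velocity_integral (c : R) (g : R -> R) : 0 < c -> (forall t, 0 <= g t) ->
  {ae mu, forall t : R, 0 <= t -> 0 <= inner (dX t) (dV t) ->
     c * g t <= l * `|dX t| ^+ 2 + inner (dX t) (dV t)} ->
  exists C : R, (\int[mu]_(t in `[0%R, +oo[) (g t)%:E <= C%:E)%E.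
Proof.
move=> c0 g0 gle; have [C FC] := F_le; exists (c^-1 * (C - F 0)).
apply: (@lower_integral_le_increment _ (fun t => c^-1 * F t)) => //.
- exact: null_variationZ.
- have FF := ae_filter_ringOfSetsType mu.
  apply: (@filterS2 _ _ FF) F_derive gle => t h1 h2 t0.
  have [d Fd [h3 h4]] := h1 t0; exists (c^-1 * d); first exact: is_derive_scale.
  by rewrite ler_pdivlMl//; apply: le_trans h4; exact: h2.
- by move=> t t0; rewrite -mulrBr ler_wpM2l ?invr_ge0 ?(ltW c0)// lerD2r FC.
Qed.

Lemma velocity_sqr_integral : exists C : R,
  (\int[mu]_(t in `[0%R, +oo[) (`|dX t| ^+ 2)%:E <= C%:E)%E.
Proof.
apply: (velocity_integral l_gt0) => [t|]; first exact: sqr_ge0.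
by apply: aeW => t _; rewrite lerDl.
Qed.

Lemma velocity_product_integral : exists C : R,
  (\int[mu]_(t in `[0%R, +oo[) `|inner (dX t) (dV t)|%:E <= C%:E)%E.
Proof.
apply: (velocity_integral ltr01) => // .
apply: aeW => t _ h0; rewrite mul1r ger0_norm//.
by rewrite lerDr mulr_ge0 ?sqr_ge0// ltW.
Qed.

Let F_cvg : exists2 Finf, F t @[t --> +oo] --> Finf & forall t, 0 <= t -> F t <= Finf.
Proof. by have [C FC] := F_le; exact: nondecreasing_bounded_cvg F_nd FC. Qed.

Let prim_penalty_cvg : exists l' : R, prim (fun t => B t * psi t) t @[t --> +oo] --> l'.
Proof.
have [l' cl _] := nondecreasing_bounded_cvg
  (primitivable_nondecreasing pBpsi) prim_penalty_le.
by exists l'.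
Qed.

(** [h] is a combination of four bounded monotone functions. *)
Lemma lyapunov_cvg : exists hinf : R, h t @[t --> +oo] --> hinf.
Proof.
have [a ca] := prim_penalty_cvg.
have [b cb _] := nondecreasing_bounded_cvg (primitivable_nondecreasing pwp) prim_gap_le.
have [c cc _] := nondecreasing_bounded_cvg (primitivable_nondecreasing pD) prim_bregman_le.
have [t0|d cd _] := @nondecreasing_bounded_cvg _ Fh (2^-1 * K) Fh_nd.
  move=> t1; have := prim_gap_le t1; have := lyapunov_ge0 t0.
  have := primitivable_ge0 pD t0; have := primitivable_ge0 pBpsi t0.
  by rewrite /Fh; lra.
exists (2^-1 * b - c - 2^-1 * a - d).
have -> : h = (fun t => 2^-1 * prim wp t - prim D t -
    2^-1 * prim (fun t => B t * psi t) t - Fh t).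
  by apply/funext => t; rewrite /Fh; ring.
apply: cvgB => //; apply: cvgB; first apply: cvgB => //.
  by apply: cvgM => //; exact: cvg_cst.
by apply: cvgM => //; exact: cvg_cst.
Qed.

Lemma energy_cvg_ex : exists Einf : R, energy t @[t --> +oo] --> Einf.
Proof.
have [a ca] := prim_penalty_cvg; have [b cb _] := F_cvg.
exists (k * a - b).
have -> : energy = (fun t => k * prim (fun t => B t * psi t) t - F t).
  by apply/funext => t; rewrite /F; ring.
by apply: cvgB => //; apply: cvgM => //; exact: cvg_cst.
Qed.

(** Were the limit larger, [h] would decrease from time [T] on at rate at least [eta], and would be
    negative at time [t1]. *)
Lemma energy_lim_le (Einf : R) : energy t @[t --> +oo] --> Einf -> Einf <= V0.
Proof.
move=> cE; rewrite leNgt; apply/negP => VE.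
pose eta := (Einf - V0) / 2.
have eta0 : 0 < eta by rewrite divr_gt0// subr_gt0.
have [T0 [_ hT0]] : \forall t \near +oo, V0 + eta < energy t.
  by apply: (cvgr_gt Einf cE); rewrite /eta; lra.
pose T := Num.max T0 0 + 1.
have T1 : 0 <= T by rewrite /T addr_ge0// le_max lexx orbT.
have TE t : T <= t -> eta <= energy t - V0.
  move=> Tt; have : V0 + eta < energy t.
    apply: hT0; apply: lt_le_trans Tt; rewrite /T.
    by have := le_max T0 T0 0; rewrite lexx /=; lra.
  by lra.
pose f t := - h t - eta * Num.max t 0.
pose t1 := T + (h T + 1) / eta.
have hT := lyapunov_ge0 T.
have Tt1 : T <= t1 by rewrite lerDl divr_ge0 ?(ltW eta0)// addr_ge0.
have : f T <= f t1.
  apply: null_variation_le => //.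
    apply: null_variationB; first exact: null_variationN lyapunov_null_variation.
    exact: null_variationZ (null_variation_clip).
  move: (@ae_neq0 R) lyapunov_derive; apply: (@filterS2 _ _ (ae_filter_ringOfSetsType mu)).
  move=> r rN0 hr /andP[Tr rt]; have r0 := le_trans T1 Tr.
  have [d hd dle] := hr r0.
  have r_gt0 : 0 < r by rewrite lt_neqAle eq_sym rN0.
  exists (- d - eta * 1).
    exact: is_derive_sub (is_derive_opp hd) (is_derive_scale eta (is_derive_clip r_gt0)).
  have [_ D0 _] := pD; have := D0 r; have := TE _ Tr; move: dle; lra.
have := lyapunov_ge0 t1.
rewrite /f (max_l T1) (max_l (le_trans T1 Tt1)).
have -> : eta * t1 = eta * T + h T + 1 by rewrite /t1; field; rewrite gt_eqF.
lra.
Qed.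

(** Serves twice: as the left side is nonnegative, it bounds the limit of the energy from below;
    once that limit is known, it forces the penalty to 0. *)
Let penalty_le t : 0 < t -> B t * psi t <= 2 * (energy t - V0) + K * t^-1.
Proof.
move=> t0; have := gap_le t; have : w t <= K * t^-1.
  by rewrite ler_pdivlMr// mulrC gap_decay// ltW.
by lra.
Qed.

Lemma inv_cvg0 : (K * t^-1 : R) @[t --> +oo] --> (0 : R).
Proof.
apply/cvgrPdist_le => e e0; near=> t.
have t0 : 0 < t by near: t; exact: nbhs_pinfty_gt.
rewrite sub0r normrN normrM normfV (gtr0_norm t0) ler_pdivrMr// mulrC -ler_pdivrMr//.
Unshelve. all: by end_near. Qed.

Let penalty_squeeze (Einf : R) : energy t @[t --> +oo] --> Einf ->
  2 * (energy t - V0) + K * t^-1 @[t --> +oo] --> 2 * (Einf - V0).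
Proof.
move=> cE; rewrite -[X in _ --> X]addr0; apply: cvgD; last exact: inv_cvg0.
apply: cvgM; first exact: cvg_cst.
by apply: cvgB => //; exact: cvg_cst.
Qed.

Lemma energy_cvg : energy t @[t --> +oo] --> V0.
Proof.
have [Einf cE] := energy_cvg_ex.
suff <- : Einf = V0 by [].
apply/le_anti; rewrite energy_lim_le//=.
have : 0 <= 2 * (Einf - V0).
  apply: (cvgr_to_ge (penalty_squeeze cE)).
  near=> t; have t0 : 0 < t by near: t; exact: nbhs_pinfty_gt.
  by apply: le_trans (penalty_le t0); have [_ Bp0 _] := pBpsi; exact: Bp0.
by rewrite pmulr_rge0// subr_ge0.
Unshelve. all: by end_near. Qed.

Lemma penalty_cvg0 : B t * psi t @[t --> +oo] --> (0 : R).
Proof.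
have := penalty_squeeze energy_cvg; rewrite subrr mulr0 => c0.
apply: (squeeze_cvgr _ (cvg_cst 0) c0); near=> t.
have t0 : 0 < t by near: t; exact: nbhs_pinfty_gt.
by rewrite penalty_le// andbT; have [_ Bp0 _] := pBpsi; exact: Bp0.
Unshelve. all: by end_near. Qed.

Lemma value_cvg : phi t + theta t @[t --> +oo] --> V0.
Proof.
have -> : (fun t => phi t + theta t) = (fun t => energy t - B t * psi t).
  by apply/funext => t; rewrite /energy addrK.
by rewrite -[V0]subr0; apply: cvgB; [exact: energy_cvg|exact: penalty_cvg0].
Qed.

(** The bounded monotone primitive of [D] has small increments over late unit windows, so [D] cannot
    exceed [e] on a whole window. Nothing is claimed about the other times of the window. *)
Lemma bregman_small e : 0 < e ->
  \forall s \near +oo, exists2 t : R, s <= t <= s + 1 & D t <= e.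
Proof.
move=> e0.
have [Dinf cD Dle] := nondecreasing_bounded_cvg (primitivable_nondecreasing pD) prim_bregman_le.
near=> s.
have s0 : 0 <= s by near: s; exact: nbhs_pinfty_ge.
have Ds : Dinf - e < prim D s by near: s; apply: (cvgr_gt Dinf cD); rewrite ltrBlDr ltrDl.
apply: contrapT => nD.
have Dgt t : s <= t <= s + 1 -> e < D t.
  by move=> st; rewrite ltNge; apply/negP => Dt; apply: nD; exists t.
pose f t := prim D t - e * Num.max t 0.
have : f s <= f (s + 1).
  apply: null_variation_le => //; last 2 first.
  - by rewrite lerDl.
  - move: (@ae_neq0 R) (primitivable_is_derive pD).
    apply: (@filterS2 _ _ (ae_filter_ringOfSetsType mu)) => r rN0 hr srs.
    have r0 : 0 <= r by case/andP : srs => /(le_trans s0).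
    have r_gt0 : 0 < r by rewrite lt_neqAle eq_sym rN0.
    exists (D r - e * 1); last by rewrite mulr1 subr_ge0 ltW// Dgt.
    exact: is_derive_sub (hr r0) (is_derive_scale e (is_derive_clip r_gt0)).
  apply: null_variationB; first exact: primitivable_null_variation.
  exact: null_variationZ null_variation_clip.
have s1 : 0 <= s + 1 by rewrite addr_ge0.
by have := Dle _ s1; rewrite /f (max_l s0) (max_l s1); lra.
Unshelve. all: by end_near. Qed.

Let S t := inner (X t - z) (X t - z).

(* AM-GM: 2 M |dX| <= eta + M^2 |dX|^2 / eta. *)
Let distance_variation (M eta s t : R) : (forall r, `|X r - z| <= M) -> 0 < eta ->
  0 <= s -> s <= t ->
  `|S t - S s| <= M ^+ 2 / (eta * l) * (F t - F s) + eta * (t - s).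
Proof.
move=> XM eta0 s0 st; pose c := M ^+ 2 / (eta * l).
have M0 : 0 <= M by apply: le_trans (XM 0).
have c0 : 0 <= c by rewrite divr_ge0 ?sqr_ge0// mulr_ge0// ltW.
have FF := ae_filter_ringOfSetsType mu.
(* [e] is a sign: its two values bound the increment of [S] from above and from below. *)
have key (e : R) : `|e| = 1 -> c * F s + eta * Num.max s 0 - e * S s <=
    c * F t + eta * Num.max t 0 - e * S t.
  move=> e1; apply: (@null_variation_nondecreasing _
    (fun t => c * F t + eta * Num.max t 0 - e * S t)) => //.
    apply: null_variationB; last exact: null_variationZ.
    by apply: null_variationD; apply: null_variationZ => //; exact: null_variation_clip.
  apply: (@filterS3 _ _ FF) (@ae_neq0 R) F_derive ode => r rN0 h1 h2 r0.
  have r_gt0 : 0 < r by rewrite lt_neqAle eq_sym rN0.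
  have [d Fd [pos dle]] := h1 r0; have [dXr _ _ _ _] := h2 r0.
  have dXz : is_derive r 1 (fun s => X s - z) (dX r).
    by rewrite -[dX r]subr0; apply: is_deriveB.
  have e2 := is_derive_scale e (is_derive_inner dXz dXz).
  exists (c * d + eta * 1 - e * (inner (X r - z) (dX r) + inner (dX r) (X r - z))).
    have e3 := is_derive_scale eta (is_derive_clip r_gt0).
    exact: is_derive_sub (is_derive_add (is_derive_scale c Fd) e3) e2.
  have h3 : e * inner (dX r) (X r - z) <= `|dX r| * M.
    apply: le_trans (ler_norm _) _; rewrite normrM e1 mul1r.
    by rewrite (le_trans (norm_inner_le _ _))// ler_wpM2l.
  have h4 : 2 * (`|dX r| * M) <= eta + c * (l * `|dX r| ^+ 2).
    have -> : eta + c * (l * `|dX r| ^+ 2) = (eta ^+ 2 + (M * `|dX r|) ^+ 2) / eta.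
      by rewrite /c; field; rewrite (gt_eqF eta0) (gt_eqF l_gt0).
    rewrite ler_pdivlMr//; have := sqr_ge0 (eta - M * `|dX r|).
    by rewrite sqrrB; lra.
  have : c * (l * `|dX r| ^+ 2) <= c * d by rewrite ler_wpM2l//; lra.
  by rewrite (innerC (X r - z)); lra.
have k1 := key 1 (normr1 _); have k2 := key (-1) (normrN1 _).
rewrite (max_l s0) (max_l (le_trans s0 st)) in k1 k2; rewrite -/c.
by rewrite ler_norml; apply/andP; split; lra.
Qed.

Let near_ge_all (P : R -> Prop) : (\forall s \near +oo, P s) ->
  \forall s \near +oo, forall t, s <= t -> P t.
Proof.
move=> [T [Tr hT]]; exists T; split => // s Ts t st.
exact/hT/(lt_le_trans Ts).
Qed.

(** At a time [t] soon after [s] where [D] is small, [S t] is close to [2 * h t / L t], whose limit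
    is known; the slow variation of [S] carries this back to [s]. *)
Lemma distance_cvg : exists d : R, `|X t - z| ^+ 2 @[t --> +oo] --> d.
Proof.
have [hinf ch] := lyapunov_cvg; have [Finf cF Fle] := F_cvg.
have [M XM] := trajectory_bounded.
exists (2 * hinf / l).
have -> : (fun t => `|X t - z| ^+ 2) = S by apply/funext => t; exact: sqr_norm.
have chL : 2 * h t / L t @[t --> +oo] --> 2 * hinf / l.
  apply: cvgM; first by apply: cvgM => //; exact: cvg_cst.
  by apply: cvgV => //; rewrite gt_eqF.
apply/cvgrPdist_le => e e0.
(* Four errors of [e / 4]: the convergence of [2 * h t / L t], the term in [D], and the two terms of
   [distance_variation] over a window of length at most 1. *)
have e4 : 0 < e / 4 by rewrite divr_gt0.
pose c := M ^+ 2 / (e / 4 * l).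
have c0 : 0 <= c by rewrite divr_ge0 ?sqr_ge0// mulr_ge0// ltW.
have c1 : 0 < c + 1 by rewrite ltr_wpDl.
have d0 : 0 < e / 4 / (c + 1) by rewrite divr_gt0.
have e1 : 0 < e / 8 * l by rewrite mulr_gt0// divr_gt0.
near=> s.
have s0 : 0 <= s by near: s; exact: nbhs_pinfty_ge.
have [t /andP[st ts] Dt] : exists2 t : R, s <= t <= s + 1 & D t <= e / 8 * l.
  by near: s; exact: bregman_small.
have Fs : Finf - e / 4 / (c + 1) < F s.
  by near: s; apply: (cvgr_gt Finf cF); rewrite ltrBlDr ltrDl.
have hs : forall t, s <= t -> `|2 * hinf / l - 2 * h t / L t| <= e / 4.
  near: s; apply: near_ge_all; exact: (cvgrPdist_le _ _).1 chL _ e4.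
have t0 := le_trans s0 st.
have v1 := distance_variation XM e4 s0 st; rewrite -/c in v1.
have v2 : c * (F t - F s) <= e / 4.
  have Fts : F t - F s <= e / 4 / (c + 1) by have := Fle _ t0; lra.
  apply: (@le_trans _ _ ((c + 1) * (e / 4 / (c + 1)))); last first.
    by rewrite mulrC divfK// gt_eqF.
  apply: (@le_trans _ _ (c * (e / 4 / (c + 1)))); first by rewrite ler_wpM2l.
  by rewrite ler_wpM2r ?(ltW d0)// lerDl.
have v3 : e / 4 * (t - s) <= e / 4.
  by rewrite ler_piMr ?(ltW e4)//; lra.
have Lt0 : 0 < L t := lt_le_trans l_gt0 (lL t).
have v4 : 2 * h t / L t - S t = 2 * D t / L t.
  rewrite /h /lyapunov /S; field; by rewrite gt_eqF.
have [_ D0 _] := pD.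
have v5 : 0 <= 2 * D t / L t <= e / 4.
  rewrite divr_ge0 ?(ltW Lt0)//= ?mulr_ge0//.
  rewrite ler_pdivrMr//; apply: (@le_trans _ _ (e / 4 * l)); first by lra.
  by rewrite ler_wpM2l// ltW.
have v6 := hs _ st.
move: v1 v6 v5; rewrite -v4 !ler_norml => /andP[? ?] /andP[? ?] /andP[? ?].
by apply/andP; split; lra.
Unshelve. all: by end_near. Qed.

Lemma trajectory_asymptotics :
  [/\ exists C : R, (\int[mu]_(t in `[0%R, +oo[) (B t * psi t)%:E <= C%:E)%E,
      exists C : R, (\int[mu]_(t in `[0%R, +oo[) (`|dX t| ^+ 2)%:E <= C%:E)%E,
      exists C : R,
        (\int[mu]_(t in `[0%R, +oo[) `|inner (dX t) (dV t)|%:E <= C%:E)%E &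
      [/\ phi t + theta t @[t --> +oo] --> Phiz + Thetaz,
          B t * psi t @[t --> +oo] --> (0 : R),
          exists M, forall t, `|X t - z| <= M &
          exists d : R, `|X t - z| ^+ 2 @[t --> +oo] --> d]].
Proof.
split; [exact: penalty_integral|exact: velocity_sqr_integral|
  exact: velocity_product_integral|split].
- exact: value_cvg.
- exact: penalty_cvg0.
- exact: trajectory_bounded.
- exact: distance_cvg.
Qed.

End lyapunov.
End trajectory.

(** * Reduction of the dynamical system *)

Section halfline.
Context {R : realType}.
Notation mu := (@lebesgue_measure R).

Lemma locally_absolutely_continuous_clip {V : normedModType R} (x : R -> V) :
  locally_absolutely_continuous x -> null_variation (fun t => x (Num.max t 0)).
Proof.
move=> acx; apply: dominated_null_variation.
  by move=> t t0; rewrite maxxx max_r.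
move=> b b0; have [m [mm m0 intm hm]] := absolutely_continuous_dominated b0 (acx b b0).
exists m; split => // a c a0 ac cb.
by rewrite !max_l ?(le_trans a0)//; exact: hm.
Qed.

Lemma is_derive_comp_clip {V : normedModType R} (x : R -> V) (t : R) :
  0 < t -> derivable x t 1 -> is_derive t 1 (fun s => x (Num.max s 0)) ('D_1 x t).
Proof.
move=> t0 dx; apply: (@is_derive_near_eq _ _ x); last exact: DeriveDef.
by apply: filterS (near_gt0 t0) => s s0; rewrite max_l// ltW.
Qed.

Lemma cvg_comp_clip {T : topologicalType} (f : R -> T) (a : T) :
  f t @[t --> +oo] --> a -> f (Num.max t 0) @[t --> +oo] --> a.
Proof.
move=> fa; apply: cvg_trans fa; apply: near_eq_cvg; near=> t.
by rewrite max_l//; near: t; exact: nbhs_pinfty_ge.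
Unshelve. all: by end_near. Qed.

Lemma cvg_clip_comp {T : topologicalType} (f : R -> T) (a : T) :
  f (Num.max t 0) @[t --> +oo] --> a -> f t @[t --> +oo] --> a.
Proof.
move=> fa; apply: cvg_trans fa; apply: near_eq_cvg; near=> t.
by rewrite max_l//; near: t; exact: nbhs_pinfty_ge.
Unshelve. all: by end_near. Qed.

(** The forward step [1 / (n + 1)] gives a sequence of functions, continuous along with [x], that
    exhibits the derivative as strongly measurable. *)
Definition diff_quotient {V : normedModType R} (x : R -> V) (n : nat) (t : R) : V :=
  n.+1%:R *: (x (n.+1%:R^-1 + t) - x t).

Lemma continuous_diff_quotient {V : normedModType R} (x : R -> V) n :
  continuous x -> continuous (diff_quotient x n).
Proof.
move=> cx t.
have h : x (n.+1%:R^-1 + s) @[s --> t] --> x (n.+1%:R^-1 + t).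
  have ht : n.+1%:R^-1 + s @[s --> t] --> n.+1%:R^-1 + t.
    exact: (cvgD (cvg_cst _) cvg_id).
  exact: (cvg_comp _ _ ht (cx _)).
exact: (cvgZ (cvg_cst _) (cvgB h (cx t))).
Qed.

Lemma diff_quotient_cvg {V : normedModType R} (x : R -> V) (t : R) (d : V) :
  is_derive t 1 x d -> diff_quotient x n t @[n --> \oo] --> d.
Proof.
move=> xd; apply/cvgrPdist_le => e e0.
have [r /= r0 hr] := is_derive_near xd e0.
near=> n.
have n0 : 0 < n.+1%:R^-1 :> R by rewrite invr_gt0.
have nr : n.+1%:R^-1 < r by near: n; exact: (near_infty_natSinv_lt (PosNum r0)).
have := hr (n.+1%:R^-1 + t); rewrite /= opprD addrCA subrr addr0 normrN.
rewrite (gtr0_norm n0) => /(_ nr); rewrite addrK (gtr0_norm n0) => h.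
have -> : d - diff_quotient x n t =
    - (n.+1%:R *: (x (n.+1%:R^-1 + t) - x t - n.+1%:R^-1 *: d)).
  by rewrite /diff_quotient [in RHS]scalerBr opprB scalerA mulfV// scale1r.
rewrite normrN normrZ ger0_norm// -ler_pdivlMl//.
by rewrite mulrC.
Unshelve. all: by end_near. Qed.

End halfline.

(** * Multipliers, the conjugate gap and sublevel sets *)

Section convex_analysis.
Context {R : realType} {H : hilbertType R}.
Notation mu := (@lebesgue_measure R).
Implicit Types (Phi : H -> \bar R) (Theta Psi : H -> R).

(** By Fermat's rule 0 is a subgradient at [z] of the objective plus the indicator, and the sum rule
    splits it. *)
Lemma optimality_multiplier Phi Theta Psi (z : H) :
  (forall y, Phi y != -oo%E) ->
  (forall z, subdiff (fun y => Phi y + (Theta y)%:E + indicator_fun (argmin Psi) y)%E z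
     = [set a + gradient Theta z + c
         | a in subdiff Phi z & c in normal_cone (argmin Psi) z]) ->
  optimal_solutions Phi Theta Psi z ->
  exists p, normal_cone (argmin Psi) z p /\
    subdiff Phi z (- (p + gradient Theta z)).
Proof.
move=> PhiN sum [Cz dz hz].
have fz : Phi z \is a fin_num by rewrite fin_numE PhiN lt_eqF.
have Iz : indicator_fun (argmin Psi) z = 0%E by rewrite /indicator_fun mem_set.
have : subdiff (fun y => Phi y + (Theta y)%:E + indicator_fun (argmin Psi) y)%E z 0.
  split => [|y]; rewrite Iz adde0; first by rewrite fin_numD fz.
  rewrite inner0l adde0 /indicator_fun; case: ifPn => [/set_mem/hz|_].
    by rewrite adde0.
  (* Outside the constraint set the sum is [+oo], since [Phi] never takes the value [-oo]. *)
  rewrite addey ?leey//.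
  by rewrite -ltNye; case: (Phi y) (PhiN y) => // r; rewrite // -EFinD ltNyr.
rewrite sum => -[a az [c Nc eq0]].
exists c; split => //.
suff <- : a = - (c + gradient Theta z) by [].
by apply/eqP; rewrite -addr_eq0 (addrC c) addrA eq0.
Qed.

(** The Fenchel inequality at [y] bounds the conjugate from below, and normality of [q] at [z]
    bounds the support function from above by the inner product with [z]. *)
Lemma penalty_gap_conjugate Psi (q z : H) (b : R) (y : H) : 0 < b ->
  normal_cone (argmin Psi) z q ->
  ((inner q (y - z) - b * Psi y)%:E <=
   b%:E * (conjugate (EFin \o Psi) (b^-1 *: q) -
           support_fun (argmin Psi) (b^-1 *: q)))%E.
Proof.
move=> b0 [Cz Nq].
have -> : inner q (y - z) - b * Psi y =
   b * ((inner (b^-1 *: q) y - Psi y) - inner (b^-1 *: q) z).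
  by rewrite innerBr !innerZl; field; rewrite gt_eqF.
rewrite EFinM lee_wpmul2l// ?lee_fin ?(ltW b0)// EFinB leeB//.
  by apply: ereal_sup_ubound; exists y.
apply: ge_ereal_sup => _ [u Cu <-]; rewrite lee_fin !innerZl ler_wpM2l ?invr_ge0 ?(ltW b0)//.
by have := Nq u Cu; rewrite innerBr subr_le0.
Qed.

(** Closedness and convexity together give weak closedness, through which bounds on the objective
    pass to weak limits of the trajectory. *)
Lemma sublevel_closed_convex Phi Theta (a : R) :
  (forall y, Phi y != -oo%E) -> ereal_convex Phi -> lower_semicontinuous Phi ->
  convex_function setT Theta -> Frechet_differentiable Theta ->
  closed [set y | (Phi y + (Theta y)%:E <= a%:E)%E] /\
  convex_subset [set y | (Phi y + (Theta y)%:E <= a%:E)%E].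
Proof.
move=> PhiN cvxP lscP cvxT dT; split.
  rewrite -[X in closed X]setCK; apply: open_closedC.
  rewrite openE => y /= /negP; rewrite -ltNge => ay.
  have : ((a - Theta y)%:E < Phi y)%E by rewrite EFinB lteBlDr.
  move=> ay'.
  (* The level [c] separates the two functions: semicontinuity keeps [Phi] above [c] near [y],
     continuity keeps [Theta] above [a - c]. *)
  have [c ac cy] : exists2 c : R, a - Theta y < c & (c%:E < Phi y)%E.
    case: (Phi y) ay' (PhiN y) => [r| |] //.
      rewrite lte_fin => h _; exists ((a - Theta y + r) / 2); rewrite ?lte_fin; lra.
    by exists (a - Theta y + 1); rewrite ?ltry//; lra.
  have [W Wy hW] := lscP _ _ cy.
  have Ty : \forall u \near y, a - c < Theta u.
    have : Theta u @[u --> y] --> (Theta y : R^o).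
      by apply: (@differentiable_continuous _ _ _ y (Theta : H -> R^o)); exact: dT.
    by move=> /cvgr_gt; apply; lra.
  move: Wy Ty; apply: filterS2 => u /hW cu au /=; apply/negP; rewrite -ltNge.
  have -> : a = c + (a - c) by ring.
  by rewrite EFinD lteD// lte_fin.
move=> x y t /= hx hy t01; have /andP[t0 t1] := t01.
have convT : Theta (t *: x + (1 - t) *: y) <= t * Theta x + (1 - t) * Theta y.
  by have := cvxT (Itv01 (ltW t0) (ltW t1)) x y (in_setT _) (in_setT _).
have := cvxP x y t t01.
move: hx hy (PhiN x) (PhiN y) (PhiN (t *: x + (1 - t) *: y)).
case: (Phi x) => [r| |] //; case: (Phi y) => [s| |] //.
rewrite -!EFinD !lee_fin => hx hy _ _.
case: (Phi _) => [u| |] // _; rewrite -?EFinM -?EFinD !lee_fin => hu.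
have h1 : 0 <= t * (a - (r + Theta x)) by rewrite mulr_ge0 ?(ltW t0)//; lra.
have h2 : 0 <= (1 - t) * (a - (s + Theta y)) by rewrite mulr_ge0//; lra.
by lra.
Qed.

End convex_analysis.

(** * Transfer of the trajectory estimates to the solution *)

Theorem theorem15 (R : realType) (H : hilbertType R)
  (Psi Theta : H -> R) (Phi : H -> \bar R) (lambda beta : R -> R)
  (x0 v0 : H) (x v : R -> H)
  (* (1) *)
  (Psi_ge0 : forall z, 0 <= Psi z)
  (Psi_convex : convex_function setT Psi)
  (Psi_diff : Frechet_differentiable Psi)
  (Psi_lip : lipschitz (gradient Psi))
  (argmin_Psi : argmin Psi = Psi @^-1` [set 0])
  (argmin_Psi_neq0 : argmin Psi !=set0)
  (* (2) *)
  (Theta_convex : convex_function setT Theta)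
  (Theta_diff : Frechet_differentiable Theta)
  (Theta_lip : lipschitz (gradient Theta))
  (* (3) *)
  (Phi_nNoo : forall z, Phi z != -oo%E)
  (Phi_convex : ereal_convex Phi)
  (Phi_lsc : lower_semicontinuous Phi)
  (S_neq0 : optimal_solutions Phi Theta Psi !=set0)
  (* (4) *)
  (lambda_gt0 : forall t : R, 0 <= t -> 0 < lambda t)
  (lambda_ac : locally_absolutely_continuous (lambda : R -> R^o))
  (lambda_dec : {ae (@lebesgue_measure R), forall t : R, 0 <= t ->
     derivable (lambda : R -> R^o) t 1 /\ 'D_1 (lambda : R -> R^o) t <= 0})
  (lambda_lim : exists2 l : R, 0 < l & lambda t @[t --> +oo] --> l)
  (* (5) *)
  (beta_gt0 : forall t : R, 0 <= t -> 0 < beta t)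
  (beta_ac : locally_absolutely_continuous (beta : R -> R^o))
  (beta_growth : exists2 k : R, 0 <= k &
     {ae (@lebesgue_measure R), forall t : R, 0 <= t ->
       derivable (beta : R -> R^o) t 1 /\
       0 <= 'D_1 (beta : R -> R^o) t <= k * beta t})
  (beta_lim : beta t @[t --> +oo] --> +oo)
  (* (6) *)
  (conj_integrable : forall p, ran_normal_cone (argmin Psi) p ->
     (\int[@lebesgue_measure R]_(t in `[0%R, +oo[)
        ((beta t)%:E * (conjugate (EFin \o Psi) ((beta t)^-1 *: p)
                        - support_fun (argmin Psi) ((beta t)^-1 *: p)))
      < +oo)%E)
  (* (7) *)
  (subdiff_sum : forall z,
     subdiff (fun y => Phi y + (Theta y)%:E + indicator_fun (argmin Psi) y)%E z
     = [set a + gradient Theta z + c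
         | a in subdiff Phi z & c in normal_cone (argmin Psi) z])
  (v0_subdiff : subdiff Phi x0 v0)
  (xv_solution :
     strong_global_solution Phi Theta Psi lambda beta x0 v0 x v) :
  (* (i) *)
  (\int[@lebesgue_measure R]_(t in `[0%R, +oo[)
      (beta t * Psi (x t))%:E < +oo)%E /\
  (* (ii) *)
  in_Lp 2 `[0, +oo[ ('D_1 x) /\
  (* (iii) *)
  in_Lp 1 `[0, +oo[ (fun t => inner ('D_1 x t) ('D_1 v t) : R^o) /\
  (* (iv) *)
  (Phi (x t) + (Theta (x t))%:E)%E @[t --> +oo] -->
    optimal_value Phi Theta Psi /\
  (* (v) *)
  (Psi (x t) @[t --> +oo] --> (0 : R) /\
   beta t * Psi (x t) @[t --> +oo] --> (0 : R)) /\
  (* (vi) *)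
  (exists2 z, optimal_solutions Phi Theta Psi z & weakly_cvg_pinfty x z).
Proof.
case: xv_solution => -[acx acv] vsub dyn [x0E v0E].
have FF := ae_filter_ringOfSetsType (@lebesgue_measure R).
have [l l0 lambdal] := lambda_lim; have [k k0 beta_ae] := beta_growth.
pose c (t : R) := Num.max t 0.
have c0 t : 0 <= c t by rewrite /c le_max lexx orbT.
have cE t : 0 <= t -> c t = t by move=> t0; rewrite /c max_l.
have cN t : t <= 0 -> c t = c 0 by move=> t0; rewrite /c max_r// maxxx.
(* Freezing the curves at negative times makes them continuous on the whole line. *)
pose X t := x (c t); pose V t := v (c t).
pose L t := lambda (c t); pose B t := beta (c t).
have nvX : null_variation X := locally_absolutely_continuous_clip acx.
have nvV : null_variation V := locally_absolutely_continuous_clip acv.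
have nvL : null_variation (L : R -> R^o) := locally_absolutely_continuous_clip lambda_ac.
have nvB : null_variation (B : R -> R^o) := locally_absolutely_continuous_clip beta_ac.
have XN t : t <= 0 -> X t = X 0 by move=> /cN h; rewrite /X h.
have VN t : t <= 0 -> V t = V 0 by move=> /cN h; rewrite /V h.
have LN t : t <= 0 -> L t = L 0 by move=> /cN h; rewrite /L h.
have BN t : t <= 0 -> B t = B 0 by move=> /cN h; rewrite /B h.
have cX : continuous X by exact: null_variation_const_continuous.
have cV : continuous V by exact: null_variation_const_continuous.
pose phi t := fine (Phi (X t)); pose theta t := Theta (X t); pose psi t := Psi (X t).
pose gT t := gradient Theta (X t); pose gP t := gradient Psi (X t).
have finX t : Phi (X t) \is a fin_num by have [] := vsub _ (c0 t).
have sub_z t y : Phi y \is a fin_num -> phi t + inner (V t) (y - X t) <= fine (Phi y).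
  move=> fy; have [_ /(_ y)] := vsub _ (c0 t).
  by rewrite -lee_fin EFinD !fineK.
have phi_sub t s : phi t + inner (V t) (X s - X t) <= phi s by exact: sub_z.
have subT := gradient_subgradient Theta_convex Theta_diff.
have subP := gradient_subgradient Psi_convex Psi_diff.
have theta_sub t s : theta t + inner (gT t) (X s - X t) <= theta s by exact: subT.
have psi_sub t s : psi t + inner (gP t) (X s - X t) <= psi s by exact: subP.
have cgT : continuous gT.
  move=> t; apply: (@continuous_comp _ _ _ X (gradient Theta) t (cX t)).
  exact: gradient_lipschitz_continuous.
have cgP : continuous gP.
  move=> t; apply: (@continuous_comp _ _ _ X (gradient Psi) t (cX t)).
  exact: gradient_lipschitz_continuous.
have psi_ge0 t : 0 <= psi t by exact: Psi_ge0.
have B_gt0 t : 0 < B t by exact: beta_gt0.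
pose dX := 'D_1 x; pose dV := 'D_1 v.
pose dL := 'D_1 (lambda : R -> R^o); pose dB := 'D_1 (beta : R -> R^o).
have ode : {ae (@lebesgue_measure R), forall t : R, 0 <= t ->
  [/\ is_derive t 1 X (dX t), is_derive t 1 V (dV t),
      is_derive t 1 (L : R -> R^o) (dL t), is_derive t 1 (B : R -> R^o) (dB t) &
      [/\ dL t <= 0, 0 <= dB t <= k * B t &
          L t *: dX t + dV t + V t + gT t + B t *: gP t = 0]]}.
  apply: (@filterS3 _ _ FF) (filterI (@ae_neq0 R) dyn) lambda_dec beta_ae.
  move=> t [tN0 h1] h2 h3 t0.
  have t_gt0 : 0 < t by rewrite lt_neqAle eq_sym tN0.
  have [dx dv eq0] := h1 t0; have [dl l_le] := h2 t0; have [db b_le] := h3 t0.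
  split; try exact: is_derive_comp_clip.
  by split => //; rewrite /B /L /V /gT /gP /X cE.
have B_nd s t : 0 <= s -> s <= t -> B s <= B t.
  apply: null_variation_nondecreasing => //.
  apply: (@filterS _ _ FF) ode => r h r0; have [_ _ _ dBr [_ /andP[? _] _]] := h r0.
  by exists (dB r).
have L_ni s t : 0 <= s -> s <= t -> L t <= L s.
  move=> s0 st; rewrite -lerN2; move: s t s0 st.
  apply: (@null_variation_nondecreasing _ (fun t => - L t)).
    exact: null_variationN.
  apply: (@filterS _ _ FF) ode => r h r0; have [_ _ dLr _ [? _ _]] := h r0.
  by exists (- dL r); [exact: is_derive_opp|rewrite oppr_ge0].
have cL : L t @[t --> +oo] --> l by exact: cvg_comp_clip lambdal.
have lL t : l <= L t.
  have -> : L t = L (c t) by rewrite /L (cE (c t)).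
  apply: (cvgr_to_le cL); near=> s; apply: L_ni; first exact: c0.
  by near: s; apply: nbhs_pinfty_ge; exact: num_real.
have asym z : optimal_solutions Phi Theta Psi z ->
  [/\ exists C : R,
        (\int[@lebesgue_measure R]_(t in `[0%R, +oo[) (B t * psi t)%:E <= C%:E)%E,
      exists C : R,
        (\int[@lebesgue_measure R]_(t in `[0%R, +oo[) (`|dX t| ^+ 2)%:E <= C%:E)%E,
      exists C : R,
        (\int[@lebesgue_measure R]_(t in `[0%R, +oo[) `|inner (dX t) (dV t)|%:E
          <= C%:E)%E &
      [/\ phi t + theta t @[t --> +oo] --> fine (Phi z) + Theta z,
          B t * psi t @[t --> +oo] --> (0 : R),
          exists M, forall t, `|X t - z| <= M &
          exists d : R, `|X t - z| ^+ 2 @[t --> +oo] --> d]].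
  move=> Sz; have [Cz dz _] := Sz.
  have fz : Phi z \is a fin_num by rewrite fin_numE Phi_nNoo lt_eqF.
  have [p [Np [_ pz]]] := optimality_multiplier Phi_nNoo subdiff_sum Sz.
  have Psi_z : Psi z = 0 by move: Cz; rewrite argmin_Psi.
  pose q := 2 *: p.
  have Nq : normal_cone (argmin Psi) z q.
    by split => // y Cy; rewrite innerZl pmulr_rle0//; case: Np => _; exact.
  set G := (fun t : R => ((beta t)%:E *
    (conjugate (EFin \o Psi) ((beta t)^-1 *: q) -
     support_fun (argmin Psi) ((beta t)^-1 *: q)))%E).
  (* The point [y] is independent of the time: it will be the current position, a later position, or
     [z], which gives the sign of [G]. *)
  have Ggap (t : R) y : 0 <= t -> ((inner q (y - z) - beta t * Psi y)%:E <= G t)%E.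
    by move=> t0; apply: penalty_gap_conjugate => //; exact: beta_gt0.
  have G0 (t : R) : 0 <= t -> (0 <= G t)%E.
    by move=> t0; have := Ggap t z t0; rewrite subrr inner0r Psi_z mulr0 subrr.
  have G0' (t : R) : `[0, +oo[%classic t -> (0 <= G t)%E.
    by rewrite /= in_itv/= andbT => /G0.
  set I := (\int[@lebesgue_measure R]_(t in `[0%R, +oo[) G t)%E.
  have Ifin : I \is a fin_num.
    rewrite ge0_fin_numE; first by apply: conj_integrable; exists z.
    exact: integral_ge0.
  have K0 : 0 <= fine I by rewrite fine_ge0// integral_ge0.
  have sub0t (t : R) : `[0, t]%classic `<=` `[0, +oo[%classic.
    by move=> r /=; rewrite !in_itv/= andbT => /andP[].
  apply: (@trajectory_asymptotics _ _ X V gT gP dX dV L B dL dB phi theta psi k l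
    _ _ _ _ _ _ _ _ _ _ _ _ _ _ _ _ _ _ _ _ z p (fine (Phi z)) (Theta z) (fine I))
    => //.
  - by move=> t; exact: sub_z.
  - by move=> t; exact: subT.
  - by move=> t; rewrite -Psi_z; exact: subP.
  (* The terms in the gradient of [Theta] at [z] cancel. *)
  - move=> t; have := pz (X t); have := subT z (X t).
    rewrite -(fineK fz) -(fineK (finX t)) -EFinD lee_fin innerNl innerDl.
    by rewrite /phi /theta; lra.
  - (* beta is nondecreasing, so the gap at time t is at most G at every r <= t *)
    move=> t t0; have [wt|wt] := leP (penalty_gap X B psi z p t) 0.
      by apply: le_trans K0; rewrite mulr_ge0_le0.
    rewrite -lee_fin fineK// mulrC.
    have -> : ((penalty_gap X B psi z p t * t)%:E = \int[@lebesgue_measure R]_(r in `[0%R, t])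
        (penalty_gap X B psi z p t)%:E)%E.
      rewrite integral_cst// EFinM; congr (_ * _)%E; apply/esym.
      have mu0t : lebesgue_measure `[0, t]%classic = t%:E.
        rewrite lebesgue_measure_itv/= lte_fin; case: ltP => [_|t0'].
          by rewrite oppr0 adde0.
        by rewrite (le_anti (introT andP (conj t0' t0))).
      exact: mu0t.
    apply: ge0_lower_integral_le => [|r|//]; first exact: sub0t.
    rewrite /= in_itv/= => /andP[r0 rt]; rewrite lee_fin (ltW wt)/=.
    apply: le_trans (Ggap r (X t) r0); rewrite lee_fin /penalty_gap innerZl lerD2l lerN2.
    rewrite ler_wpM2r//; apply: le_trans (B_nd _ _ r0 rt).
    by rewrite /B cE.
  - move=> t t0; rewrite fineK//.
    apply: ge0_lower_integral_le => [|r|//]; first exact: sub0t.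
    rewrite /= in_itv/= => /andP[r0 rt].
    rewrite lee_fin le_max lexx orbT/= /penalty_gap_pos /Num.max; case: ifP => _.
      exact: G0.
    apply: le_trans (Ggap r (X r) r0); rewrite lee_fin /penalty_gap innerZl.
    by rewrite /B cE.
have [z0 Sz0] := S_neq0.
have [[C1 h1] [C2 h2] [C3 h3] [h4 h5 [M XM] _]] := asym z0 Sz0.
have [Cz0 dz0 minz0] := Sz0.
have fz0 : Phi z0 \is a fin_num by rewrite fin_numE Phi_nNoo lt_eqF.
have valE : optimal_value Phi Theta Psi = (fine (Phi z0) + Theta z0)%:E.
  rewrite EFinD fineK//; apply/le_anti/andP; split.
    by apply: ereal_inf_lbound; exists z0.
  by apply: le_ereal_inf_tmp => _ [y Cy <-]; exact: minz0.
(* [B t] is at least [B 0 > 0], which lets the limit pass from [B t * psi t] to [psi t]. *)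
have psi0 : psi t @[t --> +oo] --> (0 : R).
  have h5' : (B 0)^-1 * (B t * psi t) @[t --> +oo] --> (0 : R).
    by rewrite -[X in _ --> X](mulr0 (B 0)^-1); apply: cvgM => //; exact: cvg_cst.
  apply: (squeeze_cvgr _ (cvg_cst 0) h5'); near=> t.
  rewrite psi_ge0/= ler_pdivlMl ?B_gt0// ler_wpM2r ?psi_ge0//.
  apply: B_nd; first exact: lexx.
  by near: t; exact: nbhs_pinfty_ge.
split; first (apply: le_lt_trans (ltry C1); apply: le_trans h1).
  rewrite le_eqVlt; apply/orP; left; apply/eqP; apply: eq_integral => t.
  by rewrite inE/= in_itv/= andbT => t0; rewrite /B /psi /X cE.
split.
  split; last exact: le_lt_trans h2 (ltry _).
  apply: (@strongly_measurable_lim _ _ (diff_quotient X)).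
    by move=> n; exact: continuous_diff_quotient.
  by apply: (@filterS _ _ FF) ode => t h t0; have [dXt _ _ _ _] := h t0;
     exact: diff_quotient_cvg.
split.
  split; last exact: le_lt_trans h3 (ltry _).
  apply: (@strongly_measurable_lim _ _
    (fun n t => inner (diff_quotient X n t) (diff_quotient V n t) : R^o)).
    by move=> n t; apply: cvg_inner; exact: continuous_diff_quotient.
  apply: (@filterS _ _ FF) ode => t h t0; have [dXt dVt _ _ _] := h t0.
  by apply: cvg_inner; exact: diff_quotient_cvg.
split.
  rewrite valE; apply: (@cvg_clip_comp _ _ (fun t : R => Phi (x t) + (Theta (x t))%:E)%E).
  have -> : (fun t : R => Phi (x (Num.max t 0%R)) + (Theta (x (Num.max t 0%R)))%:E)%E =
      (fun t : R => (phi t + theta t)%:E).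
    by apply/funext => t; rewrite EFinD fineK//; exact: finX.
  by apply: cvg_EFin; [exact: nearW|exact: h4].
split.
  by split; [exact: (@cvg_clip_comp _ _ (Psi \o x))|
    apply: (@cvg_clip_comp _ _ (fun t => beta t * Psi (x t)))].
have XM' t : `|X t| <= M + `|z0|.
  by rewrite -[X in `|X|](subrK z0) (le_trans (ler_normD _ _))// lerD2r.
have [||z Sz xz] := @opial _ _ _ (+oo_R) _ X (optimal_solutions Phi Theta Psi) _ XM'.
- by move=> z /asym[_ _ _ [_ _ _ h]].
- move=> U z UU FU xz.
  (* The affine minorant of [Psi] tangent at [z] is weakly continuous and stays below [psi t], so
     [Psi z] is at most 0. *)
  have Cz : argmin Psi z.
    rewrite argmin_Psi /=; apply/le_anti; rewrite Psi_ge0 andbT.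
    have psiU : psi t @[t --> U] --> (0 : R) by move=> A /psi0; exact: FU.
    have linU : Psi z + inner (X t) (gradient Psi z) - inner z (gradient Psi z)
        @[t --> U] --> Psi z.
      rewrite -[X in _ --> X](addrK (inner z (gradient Psi z))).
      by apply: cvgB; [apply: cvgD; [exact: cvg_cst|exact: xz]|exact: cvg_cst].
    apply: (ler_cvg_to linU psiU); apply: nearW => t.
    have := subP z (X t); rewrite innerC innerBl; rewrite addrA; exact.
  set V0 := fine (Phi z0) + Theta z0.
  have V0E : V0%:E = (Phi z0 + (Theta z0)%:E)%E by rewrite EFinD fineK.
  (* The trajectory eventually lies in the sublevel set at [V0 + e], which contains the weak limits
     of its points. *)
  have zV : (Phi z + (Theta z)%:E <= V0%:E)%E.
    apply/lee_addgt0Pr => e e0; rewrite -EFinD.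
    have [clC cvxC] := sublevel_closed_convex (V0 + e) Phi_nNoo Phi_convex Phi_lsc
      Theta_convex Theta_diff.
    apply: (closed_convex_weak_limit clC cvxC _ xz); apply: FU; near=> t.
    rewrite /= -(fineK (finX t)) -EFinD lee_fin ltW//; near: t.
    by apply: (cvgr_lt _ h4); rewrite ltrDl.
  split=> //.
    rewrite /dom/=; move: zV; case: (Phi z) (Phi_nNoo z) => // r _ _; exact: ltry.
  by move=> y Cy; apply: (le_trans zV); rewrite V0E; exact: minz0.
exists z => // w; exact: (@cvg_clip_comp _ _ (fun t => inner (x t) w)) (xz w).
Unshelve. all: by end_near. Qed.
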